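(* Consider the system $$\ddot{x}(t)+a_1(t)\dot{x}(h_1(t))+a_2(t)x(h_2(t))+a_3(t)u(h_3(t))=0,\quad t\ge 0,$$ $$\dot{u}(t)+b_1(t)u(g_1(t))+b_2(t)x(g_2(t))=0,\quad t\ge 0,$$ where the coefficients and delays satisfy the standing assumptions in the context, with delay bounds $\tau_1,\tau_2,\tau_3,\sigma_1,\sigma_2$. Assume that for some $t_0\ge 0$ there are constants $\alpha_1,\alpha_2,\beta_1>0$ and $A_1,A_2,A_3,B_1,B_2$ such that for $t\ge t_0$ $$0<\alpha_i\le a_i(t)\le A_i\ (i=1,2),\quad |a_3(t)|\le A_3,\quad 0<\beta_1\le b_1(t)\le B_1,\quad |b_2(t)|\le B_2,$$ and $\alpha_1^2\ge 4A_2$. Writing $\|\cdot\|=\|\cdot\|_{[t_0,\infty)}$ for the essential supremum norm on $[t_0,\infty)$, let $$A=\begin{pmatrix} 0&\tau_2&\tau_1\left\|\frac{a_1}{a_2}\right\|&\left\|\frac{a_3}{a_2}\right\|&0\\ \left\|\frac{a_2}{a_1}\right\|&0&\tau_1&\left\|\frac{a_3}{a_1}\right\|&0\\ \|a_2\|&\|a_1\|&0&\|a_3\|&0\\ \left\|\frac{b_2}{b_1}\right\|&0&0&0&\sigma_1\\ \|b_2\|&0&0&\|b_1\|&0 \end{pmatrix}.$$ Assume that the spectral radius of $A$ is less than one or, equivalently, that $I-A$ is a non-singular $M$-matrix, where $I$ is the $5\times5$ identity matrix. Then the system is uniformly exponentially stable.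
   Context: Standing assumptions on the system: $a_i$ ($i=1,2,3$) and $b_i$ ($i=1,2$) are Lebesgue measurable, essentially bounded functions $[0,\infty)\to\mathbb{R}$; $h_i:[-\tau_i,\infty)\to\mathbb{R}$ ($i=1,2,3$) and $g_i:[-\sigma_i,\infty)\to\mathbb{R}$ ($i=1,2$) are Lebesgue measurable with $0\le t-h_i(t)\le\tau_i$ and $0\le t-g_i(t)\le\sigma_i$ for $t\ge 0$, where $\tau_i,\sigma_i$ are finite constants. Norm: for a measurable essentially bounded $y:[t_0,\infty)\to\mathbb{R}$, $\|y\|_{[t_0,\infty)}=\operatorname{ess\,sup}_{t\ge t_0}|y(t)|$. Initial value problem: for an initial point $s\ge 0$, the system is considered for $t\ge s$ with initial conditions $x(t)=\varphi_1(t)$, $\dot{x}(t)=\varphi_2(t)$, $u(t)=\psi(t)$ for $t\le s$, where $\varphi_1,\varphi_2,\psi:[s-\max_j\{\tau_j,\sigma_j\},s]\to\mathbb{R}$ are arbitrary Borel measurable bounded functions. ($\varphi_2$ is prescribed independently of $\varphi_1$: whenever a delayed argument is $\le s$, the values of $x,\dot{x},u$ at it are taken to be those of $\varphi_1,\varphi_2,\psi$.) A solution is a pair $(x,u)$ such that $\dot{x}$ and $u$ are locally absolutely continuous on $[s,\infty)$, the two equations hold for almost every $t>s$, and the initial conditions hold for $t\le s$. The solution exists and is unique. Uniform exponential stability: the system is uniformly exponentially stable if there exist $M>0$, $\mu>0$, independent of $s\ge 0$ and of the initial functions $\varphi_1,\varphi_2,\psi$, such that the solution satisfies $$\max\{|x(t)|,|u(t)|\}\le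 M e^{-\mu(t-s)}\sup_{\theta\le s}\bigl(|\varphi_1(\theta)|+|\varphi_2(\theta)|+|\psi(\theta)|\bigr),\quad t\ge s,$$ where the supremum is over $\theta$ in the domain $[s-\max_j\{\tau_j,\sigma_j\},s]$ of the initial functions. $M$-matrix: a real matrix $B=(b_{ij})_{i,j=1}^m$ is a non-singular $M$-matrix if $b_{ij}\le 0$ for $i\ne j$ and $B$ is invertible with $B^{-1}\ge 0$ entrywise (equivalently, all leading principal minors of $B$ are positive). *)

(* Defs.v *)
From mathcomp Require Import all_boot all_order all_algebra.
From mathcomp Require Import complex.
From mathcomp Require Import all_classical all_reals all_analysis.
From mathcomp Require Import measurable_realfun ess_sup_inf.

Set Implicit Arguments.
Unset Strict Implicit.
Unset Printing Implicit Defensive.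

Import Order.TTheory GRing.Theory Num.Theory.
Import numFieldNormedType.Exports.

Local Open Scope classical_set_scope.
Local Open Scope ring_scope.

(* The canonical measurable structure on R is the Borel one; this is the
   sigma-algebra of Lebesgue measurable sets (Borel sets up to null sets). *)
Definition lebesgueType (R : realType) : Type :=
  g_sigma_algebraType (completed_algebra_gen (@lebesgue_measure R)).

Definition lebesgue_measurable_on (R : realType) (D : set R) (f : R -> R) :=
  measurable_fun (D : set (lebesgueType R)) (f : lebesgueType R -> R).

Definition ess_bounded_on (R : realType) (D : set R) (f : R -> R) :=
  exists C : R,
    {ae @lebesgue_measure R, forall t, D t -> `|f t| <= C}.

Definition ess_norm (R : realType) (t0 : R) (y : R -> R) : R :=
  fine (ess_sup
    (mrestr (@lebesgue_measure R) (measurable_itv `[t0, +oo[%R))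
    (fun t => (`|y t|)%:E)).

Definition abs_continuous_on (R : realType) (a b : R) (f : R -> R) :=
  forall eps : R, 0 < eps -> exists2 delta : R, 0 < delta &
    forall (n : nat) (l r : 'I_n -> R),
      (forall i, a <= l i /\ l i <= r i /\ r i <= b) ->
      trivIset setT (fun i : 'I_n => `](l i), (r i)[%classic) ->
      \sum_(i < n) (r i - l i) < delta ->
      \sum_(i < n) `|f (r i) - f (l i)| < eps.

Definition loc_abs_continuous_from (R : realType) (s : R) (f : R -> R) :=
  forall T : R, s <= T -> abs_continuous_on s T f.

(* x''(t) + a1(t) x'(h1(t)) + a2(t) x(h2(t)) + a3(t) u(h3(t)) = 0,
   u'(t) + b1(t) u(g1(t)) + b2(t) x(g2(t)) = 0;
   tau_i bounds the delay t - h_i(t), sigma_i bounds t - g_i(t). *)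
Record delay_system (R : realType) := DelaySystem {
  a1 : R -> R; a2 : R -> R; a3 : R -> R;
  b1 : R -> R; b2 : R -> R;
  h1 : R -> R; h2 : R -> R; h3 : R -> R;
  g1 : R -> R; g2 : R -> R;
  tau1 : R; tau2 : R; tau3 : R;
  sigma1 : R; sigma2 : R }.

Definition coefficient_ok (R : realType) (a : R -> R) :=
  lebesgue_measurable_on `[0, +oo[%classic a /\
  ess_bounded_on `[0, +oo[%classic a.

Definition delay_ok (R : realType) (tau : R) (h : R -> R) :=
  lebesgue_measurable_on `[- tau, +oo[%classic h /\
  (forall t, 0 <= t -> 0 <= t - h t <= tau).

Definition standing_assumptions (R : realType) (S : delay_system R) : Prop :=
  [/\ coefficient_ok (a1 S), coefficient_ok (a2 S) & coefficient_ok (a3 S)] /\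
  [/\ coefficient_ok (b1 S) & coefficient_ok (b2 S)] /\
  [/\ delay_ok (tau1 S) (h1 S), delay_ok (tau2 S) (h2 S)
    & delay_ok (tau3 S) (h3 S)] /\
  [/\ delay_ok (sigma1 S) (g1 S) & delay_ok (sigma2 S) (g2 S)].

Definition max_delay (R : realType) (S : delay_system R) : R :=
  Num.max (Num.max (tau1 S) (Num.max (tau2 S) (tau3 S)))
          (Num.max (sigma1 S) (sigma2 S)).

Definition history (R : realType) (S : delay_system R) (s : R) : set R :=
  `[s - max_delay S, s]%classic.

Definition initial_function (R : realType) (S : delay_system R) (s : R)
    (phi : R -> R) : Prop :=
  measurable_fun (history S s) phi /\
  exists C : R, forall t, history S s t -> `|phi t| <= C.

(* The derivative of x as it enters the system: up to and including time s it
   is the prescribed phi2, which need not be related to phi1. *)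
Definition xdot (R : realType) (s : R) (phi2 x : R -> R) : R -> R :=
  fun t => if t <= s then phi2 t else derive1 x t.

(* Derivability is required explicitly because derive1 f t is a default value
   where f is not derivable. At s only the right derivative of x is
   constrained, since x may jump on the left of s. *)
Definition is_solution (R : realType) (S : delay_system R) (s : R)
    (phi1 phi2 psi x u : R -> R) : Prop :=
  let v := xdot s phi2 x in
  [/\ forall t, history S s t -> x t = phi1 t /\ u t = psi t,
      (forall t, s < t -> derivable x t 1) /\
      h^-1 * (x (s + h) - x s) @[h --> 0^'+] --> phi2 s,
      loc_abs_continuous_from s v /\ loc_abs_continuous_from s u,
      {ae @lebesgue_measure R, forall t, s < t ->
        derivable v t 1 /\
        derive1 v t + a1 S t * v (h1 S t) + a2 S t * x (h2 S t)
                + a3 S t * u (h3 S t) = 0}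
    & {ae @lebesgue_measure R, forall t, s < t ->
        derivable u t 1 /\
        derive1 u t + b1 S t * u (g1 S t) + b2 S t * x (g2 S t) = 0}].

Definition uniformly_exponentially_stable (R : realType)
    (S : delay_system R) : Prop :=
  exists M mu : R, [/\ 0 < M, 0 < mu &
    forall (s : R) (phi1 phi2 psi : R -> R), 0 <= s ->
      initial_function S s phi1 -> initial_function S s phi2 ->
      initial_function S s psi ->
      forall x u : R -> R, is_solution S s phi1 phi2 psi x u ->
      forall t, s <= t ->
        Num.max `|x t| `|u t| <=
        M * expR (- mu * (t - s)) *
        sup [set `|phi1 th| + `|phi2 th| + `|psi th| | th in history S s]].

(* The largest modulus of a complex eigenvalue. *)
Definition spectral_radius (R : realType) (n : nat) (A : 'M[R]_n) : R :=
  sup [set complex.Re `|z| | z in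
        [set z : R[i] | eigenvalue (map_mx (real_complex R) A) z]].

Definition nonsingular_M_matrix (R : realType) (n : nat) (B : 'M[R]_n) : Prop :=
  [/\ forall i j, i != j -> B i j <= 0,
      B \in unitmx
    & forall i j, 0 <= invmx B i j].

Definition comparison_matrix (R : realType) (S : delay_system R) (t0 : R) :
    'M[R]_5 :=
  let N (y : R -> R) := ess_norm t0 y in
  let Q (y z : R -> R) := ess_norm t0 (fun t => y t / z t) in
  let rows : seq (seq R) :=
    [:: [:: 0; tau2 S; tau1 S * Q (a1 S) (a2 S); Q (a3 S) (a2 S); 0];
        [:: Q (a2 S) (a1 S); 0; tau1 S; Q (a3 S) (a1 S); 0];
        [:: N (a2 S); N (a1 S); 0; N (a3 S); 0];
        [:: Q (b2 S) (b1 S); 0; 0; 0; sigma1 S];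
        [:: N (b2 S); 0; 0; N (b1 S); 0]] in
  \matrix_(i < 5, j < 5) nth 0 (nth [::] rows i) j.

(* Main.v *)
(* The (I - A)-condition provides d > 0 and eta < 1 with A d <= eta d. On
   [t0, oo) the delayed terms are replaced by undelayed ones, e.g.
   x(t) - x(h(t)) is at most tau times a bound for x', so that each of x, x', u
   solves an ordinary differential equation whose forcing term is controlled by
   a row of A. Assume |x|, |x'|, |x''|, |u|, |u'| are bounded by
   k d_i e^(-mu (t - T0)). Comparison with this exponential barrier returns the
   same bounds for x, x', u with max(c, th k), th < 1, in place of k, where c
   only depends on the initial data; iterating gives the bound with k = c. The
   condition alpha1^2 >= 4 A2 makes the second-order operator
   x'' + a1 x' + a2 x a cooperative first-order system in x and
   w = x' + (alpha1 / 2) x, so that the barrier applies to it. Only the bounded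
   time interval before T0 remains, where a Gronwall-type growth bound is
   obtained from the same comparison with an increasing exponential. *)
Require Import Defs.
From mathcomp Require Import all_boot all_order all_algebra.
From mathcomp Require Import complex.
From mathcomp Require Import all_classical all_reals all_analysis.
From mathcomp Require Import measurable_realfun ess_sup_inf.
From mathcomp Require Import ring lra.

Set Implicit Arguments.
Unset Strict Implicit.
Unset Printing Implicit Defensive.

Import Order.TTheory GRing.Theory Num.Theory.
Import numFieldNormedType.Exports.

Local Open Scope classical_set_scope.
Local Open Scope ring_scope.

(** * Increments of absolutely continuous functions *)

(** The supremum [c] of the points of [[a, b]] where [P] holds satisfies [P] by the left half of the
    step; the right half then yields points beyond [c], unless [c = b]. *)
Lemma real_induction (R : realType) (P : R -> Prop) (a b : R) :
  a <= b -> P a ->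
  (forall c, a <= c <= b -> exists2 d : R, 0 < d &
     (forall t, a <= t <= c -> c - d < t -> P t -> P c) /\
     (forall t, c <= t <= b -> t < c + d -> P c -> P t)) ->
  P b.
Proof.
move=> ab Pa step; pose S : set R := [set t | a <= t <= b /\ P t].
have Sa : S a by split; rewrite ?lexx.
have ubS : ubound S b by move=> t [/andP[]].
have hS : has_sup S by split; [exists a|exists b].
have cab : a <= sup S <= b.
  by rewrite ub_le_sup//=; [apply: ge_sup => //; exists a|exists b].
have [d d0 [stepl stepr]] := step _ cab.
have [t [tab Pt] ct] := sup_adherent d0 hS.
have tS : t <= sup S by apply: ub_le_sup => //; exists b.
have Pc : P (sup S) by apply: (stepl t) => //; lra.
have [->//|cb] := eqVneq b (sup S).
have {}cb : sup S < b by rewrite lt_neqAle eq_sym cb; lra.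
pose t' := Num.min b (sup S + d / 2).
have [t'b [t'c ct']] : t' <= b /\ t' < sup S + d /\ sup S < t'.
  by rewrite /t'; case: (leP b (sup S + d / 2)) => ?; lra.
have : S t' by split; [lra | apply: stepr => //; lra].
by move=> /(ub_le_sup (ex_intro _ b ubS)); lra.
Qed.

(** Both upper Dini derivatives at [c] are at most [L]. Differentiability would be too much to ask:
    the positive part in [barrier_le] may have a corner. *)
Definition slope_le (R : realType) (f : R -> R) (L c : R) :=
  forall eps, 0 < eps -> exists2 d : R, 0 < d & forall t, `|t - c| < d ->
    (c <= t -> f t - f c <= (L + eps) * (t - c)) /\
    (t <= c -> f c - f t <= (L + eps) * (c - t)).

Lemma negligible_open_cover (R : realType) (Z : set R) (eps : R) : 0 < eps ->
  (@lebesgue_measure R).-negligible Z ->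
  exists U : set R,
    [/\ open U, (Z `<=` U) & (@lebesgue_measure R U < eps%:E)%E].
Proof.
move=> e0 [N [mN N0 ZN]].
have Nfin : (@lebesgue_measure R N < +oo)%E by rewrite N0.
have [U [oU NU Ue]] := lebesgue_regularity_outer mN Nfin e0.
exists U; split => //; first exact: subset_trans ZN NU.
have mU : measurable U by exact: open_measurable.
rewrite -(setDUK NU) measureU//; last 2 first.
- exact: measurableD.
- by rewrite setDE setICA setICr setI0.
by rewrite [X in (X + _)%E]N0 add0e.
Qed.

(** The sum of the lengths is the measure of a disjoint union lying in [U]. *)
Lemma itv_family_length_le (R : realType) (n : nat) (l r : nat -> R)
    (U : set R) (d : R) :
  (forall i, (i < n)%N -> l i <= r i /\ (`](l i), (r i)[%classic `<=` U)) ->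
  trivIset setT (fun i : 'I_n => `](l i), (r i)[%classic) ->
  open U -> (@lebesgue_measure R U < d%:E)%E ->
  \sum_(i < n) (r i - l i) < d.
Proof.
move=> lr triv oU Ud; rewrite -lte_fin; apply: le_lt_trans Ud.
have -> : (\sum_(i < n) (r i - l i))%:E =
    @lebesgue_measure R (\big[setU/set0]_(i < n) `](l i), (r i)[%classic).
  symmetry; 
  apply: etrans.
    apply: (@measure_bigsetU_ord _ R _ (@lebesgue_measure R) n xpredT) triv.
    by move=> i; exact: measurable_itv.
  rewrite -sumEFin; apply: eq_bigr => i _.
  have [lri _] := lr _ (ltn_ord i).
  have E : @lebesgue_measure R `](l i), (r i)[%classic = (r i - l i)%:E.
    rewrite lebesgue_measure_itv/= lte_fin.
    case: ltP => // rl; have -> : r i = l i by [apply/le_anti/andP].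
    by rewrite subrr.
  exact: E.
apply: le_measure; rewrite ?inE.
- by apply: bigsetU_measurable => i _; exact: measurable_itv.
- exact: open_measurable.
- apply: (@big_ind _ (fun A : set R => A `<=` U)) => //.
    by move=> A B AU BU x [/AU|/BU].
  by move=> i _; case: (lr _ (ltn_ord i)).
Qed.

Section increment.
Variables (R : realType) (f : R -> R) (a b : R).

(* The increment of f over [a, t] is controlled by the slope L, up to the
   increments of f over ordered non-overlapping intervals contained in U. *)
Definition controlled (U : set R) (L t : R) :=
  exists n (l r : nat -> R),
    [/\ forall i, (i < n)%N -> [/\ a <= l i, l i <= r i, r i <= t
          & `](l i), (r i)[%classic `<=` U],
        forall i j, (i < j < n)%N -> r i <= l j
      & f t - f a <= L * (t - a) + \sum_(i < n) (f (r i) - f (l i))].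

(** An interval inside [U] is appended to the family as its last member; an interval with a slope
    bound is paid for by the term in [L], and the family stays. *)
Lemma controlled_extend U L t c : 0 <= L -> a <= t -> t <= c ->
  `]t, c[%classic `<=` U \/ f c - f t <= L * (c - t) ->
  controlled U L t -> controlled U L c.
Proof.
move=> L0 at_ tc ext [n [l [r [lr ord inc]]]]; case: ext => [tcU|fct]; last first.
  exists n, l, r; split => //; last by move: inc; lra.
  by move=> i /lr[? ? rt ?]; split => //; exact: le_trans tc.
have Lct : 0 <= L * (c - t) by rewrite mulr_ge0// subr_ge0.
exists n.+1, (fun i => if (i < n)%N then l i else t),
  (fun i => if (i < n)%N then r i else c); split.
- move=> i; case: ifPn => [/lr[? ? rt ?] _|//]; split => //.
  exact: le_trans tc.
- move=> i j /andP[ij jn].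
  have i_n : (i < n)%N by rewrite (leq_trans ij)// -ltnS.
  rewrite i_n; case: ifPn => jn'; first by apply: ord; rewrite ij.
  by have [] := lr i i_n.
- rewrite big_ord_recr/= ltnn.
  rewrite (eq_bigr (fun i : 'I_n => f (r i) - f (l i))); last first.
    by move=> i _; rewrite ltn_ord.
  by move: inc; lra.
Qed.

(** The exceptional points are covered by an open set [U] of measure below the [d] of absolute
    continuity. Real induction shows that the increment over [[a, b]] is controlled: a point of [U]
    has a neighbourhood inside [U], any other point has the slope bound. The intervals inside [U]
    have total length below [d], so they contribute less than [e / 2]. *)
Lemma AC_increment_le (L : R) : 0 <= L -> a <= b -> abs_continuous_on a b f ->
  {ae @lebesgue_measure R, forall c, a < c < b -> slope_le f L c} ->
  f b - f a <= L * (b - a).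
Proof.
move=> L0 ab acf slf; apply/ler_addgt0Pr => e e0.
have e20 : 0 < e / 2 by lra.
have [d d0 fd] := acf _ e20.
(* The slack in the slope costs at most [e / 2] over [[a, b]]; the summand 1 keeps the denominator
   positive when [a = b]. *)
pose eps := e / 2 / (b - a + 1).
have eps0 : 0 < eps by rewrite divr_gt0//; lra.
have epsab : eps * (b - a) <= e / 2.
  by rewrite /eps mulrAC ler_pdivrMr ?ler_pM2l//; lra.
(* The end points join the exceptional set, because slopes are bounded only at interior points. *)
have [U [oU ZU Ud]] : exists U : set R, [/\ open U,
    ~` [set c | a < c < b -> slope_le f L c] `|` [set a] `|` [set b] `<=` U
    & (@lebesgue_measure R U < d%:E)%E].
  apply: negligible_open_cover => //.
  apply: negligibleU; first apply: negligibleU; first exact: slf.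
    by apply/negligibleP; [exact: measurable_set1|exact: lebesgue_measure_set1].
  by apply/negligibleP; [exact: measurable_set1|exact: lebesgue_measure_set1].
have L0' : 0 <= L + eps by lra.
have [n [l [r [lr ord inc]]]] : controlled U (L + eps) b.
  apply: (@real_induction R (controlled U (L + eps)) a b) => //.
    exists 0%N, (fun=> a), (fun=> a); split => //.
    by rewrite big_ord0 !subrr mulr0 addr0.
  move=> c /andP[ac cb].
  have [cU|cU] := pselect (U c).
    have [r0 /= r00 rU] : nbhs_ball c U by apply/nbhs_ballP; exact: open_nbhs_nbhs.
    exists r0 => //; split=> t /andP[t1 t2] t3 Pt.
      apply: controlled_extend Pt => //; left => x/=; rewrite in_itv/= => xt.
      by apply: rU; rewrite /ball/=; rewrite ger0_norm; lra.
    apply: controlled_extend Pt => //; left => x/=; rewrite in_itv/= => xt.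
    by apply: rU; rewrite /ball/=; rewrite ler0_norm; lra.
  have acb : a < c < b.
    rewrite !lt_neqAle ac cb !andbT; apply/andP.
    by split; apply/eqP => E; apply: cU; apply: ZU; [left; right|right].
  have sl : slope_le f L c.
    by apply: contrapT => nsl; apply: cU; apply: ZU; left; left => /(_ acb).
  have [r0 r00 rf] := sl _ eps0.
  exists r0 => //; split=> t /andP[t1 t2] t3 Pt.
    apply: controlled_extend Pt => //; right.
    by apply: (rf t _).2 => //; rewrite ler0_norm; lra.
  apply: controlled_extend Pt => //; right.
  by apply: (rf t _).1 => //; rewrite ger0_norm; lra.
have triv : trivIset setT (fun i : 'I_n => `](l i), (r i)[%classic).
  apply/trivIsetP => i j _ _; rewrite neq_ltn => /orP[] ij.
    apply/seteqP; split => // x []/=; rewrite !in_itv/=.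
    have := ord i j; rewrite ij ltn_ord => /(_ isT); lra.
  apply/seteqP; split => // x []/=; rewrite !in_itv/=.
  have := ord j i; rewrite ij ltn_ord => /(_ isT); lra.
have sumd : \sum_(i < n) (r i - l i) < d.
  by apply: itv_family_length_le triv oU Ud => i /lr[].
have lr' : forall i : 'I_n, a <= l i /\ l i <= r i /\ r i <= b.
  by move=> i; have [] := lr i (ltn_ord i).
have := fd n (fun i => l i) (fun i => r i) lr' triv sumd.
have : \sum_(i < n) (f (r i) - f (l i)) <= \sum_(i < n) `|f (r i) - f (l i)|.
  by apply: ler_sum => i _; exact: ler_norm.
by move: inc; lra.
Qed.

End increment.

(** * Calculus of absolutely continuous functions *)

Lemma AC_subitv (R : realType) (a b a' b' : R) (f : R -> R) :
  a <= a' -> b' <= b -> abs_continuous_on a b f -> abs_continuous_on a' b' f.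
Proof.
move=> aa bb acf e /acf[d d0 fd]; exists d => // n l r lr; apply: fd => i.
by have := lr i; lra.
Qed.

Lemma AC_id (R : realType) (a b : R) : abs_continuous_on a b (fun t => t).
Proof.
move=> e e0; exists e => // n l r lr _; apply: le_lt_trans.
by apply: ler_sum => i _; rewrite ger0_norm ?lexx// subr_ge0; have := lr i; lra.
Qed.

Lemma AC_dominated (R : realType) (a b c : R) (f g h : R -> R) :
  abs_continuous_on a b f -> abs_continuous_on a b g -> 0 < c ->
  (forall s t, a <= s -> s <= t -> t <= b ->
    `|h t - h s| <= c * (`|f t - f s| + `|g t - g s|)) ->
  abs_continuous_on a b h.
Proof.
move=> acf acg c0 dom e e0; pose e' := e / 2 / c.
have e'0 : 0 < e' by rewrite !divr_gt0.
have [df df0 fd] := acf _ e'0; have [dg dg0 gd] := acg _ e'0.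
exists (Num.min df dg); first by rewrite lt_min df0.
move=> n l r lr triv; rewrite lt_min => /andP[sf sg].
have hE : c * (e' + e') = e by rewrite /e'; field; rewrite gt_eqF.
apply: (@le_lt_trans _ _ (c * (\sum_(i < n) `|f (r i) - f (l i)| +
                           \sum_(i < n) `|g (r i) - g (l i)|))); last first.
  by rewrite -hE ltr_pM2l// ltrD// ?fd// gd.
rewrite -big_split mulr_sumr; apply: ler_sum => i _ /=.
by have [? [? ?]] := lr i; exact: dom.
Qed.

Lemma slope_le_is_derive (R : realType) (f : R -> R) (D L c : R) :
  is_derive c 1 f D -> D <= L -> slope_le f L c.
Proof.
move=> [df <-] DL e e0.
have := df => /cvgrPdist_lt /(_ _ e0)[d /= d0 fd].
exists d => // t tcd; have [->|tc] := eqVneq t c; first by rewrite !subrr !mulr0.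
have /= := fd (t - c); rewrite sub0r normrN subr_eq0 => /(_ tcd tc).
have -> : (t - c)%:A + c = t by rewrite /GRing.scale/= mulr1 subrK.
rewrite -/('D_1 f c) distrC => Dq.
have {}Dq : (t - c)^-1 * (f t - f c) < L + e.
  have := le_lt_trans (ler_norm _) Dq.
  by rewrite -[X in X - _]/(_ * _); lra.
split=> tc'.
  have tc0 : 0 < t - c by rewrite subr_gt0 lt_neqAle eq_sym tc.
  by move: Dq; rewrite mulrC ltr_pdivrMr// => /ltW.
have tc0 : 0 < c - t by rewrite subr_gt0 lt_neqAle tc.
by move: Dq; rewrite -mulrNN -invrN !opprB mulrC ltr_pdivrMr// => /ltW.
Qed.

Lemma lipschitz_AC (R : realType) (f : R -> R) (a b C : R) :
  (forall s t, a <= s -> s <= t -> t <= b -> `|f t - f s| <= C * (t - s)) ->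
  abs_continuous_on a b f.
Proof.
(* [AC_dominated] wants a positive constant, while [C] may be zero or negative. *)
move=> lip; have C0 : 0 < Num.max C 1 by rewrite lt_max ltr01 orbT.
apply: (AC_dominated (@AC_id _ a b) (@AC_id _ a b) C0) => s t as_ st tb.
apply: le_trans (lip _ _ as_ st tb) _.
rewrite ger0_norm ?subr_ge0//.
apply: (@le_trans _ _ (Num.max C 1 * (t - s))).
  by rewrite ler_wpM2r ?subr_ge0// le_max lexx.
by rewrite ler_pM2l//; lra.
Qed.

Lemma MVT_lipschitz (R : realType) (f df : R -> R) (a b C : R) :
  {within `[a, b]%classic, continuous f} ->
  (forall t, a < t < b -> is_derive t 1 f (df t) /\ `|df t| <= C) ->
  forall s t, a <= s -> s <= t -> t <= b -> `|f t - f s| <= C * (t - s).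
Proof.
move=> cf dfC s t as_; rewrite le_eqVlt => /predU1P[<-|st] tb.
  by rewrite !subrr normr0 mulr0.
have [|||c] := @MVT R f df s t.
- by [].
- by move=> x; rewrite in_itv/= => /andP[sx xt]; apply: (dfC _ _).1; lra.
- apply: continuous_subspaceW cf => x /=; rewrite !in_itv/=; lra.
rewrite in_itv/= => /andP[sc ct] ->.
rewrite normrM (ger0_norm (_ : 0 <= t - s)) ?subr_ge0 ?(ltW st)//.
by rewrite ler_pM2r ?subr_gt0//; apply: (dfC _ _).2; lra.
Qed.

Lemma expR_decay_is_derive (R : realType) (K mu a t : R) :
  is_derive t 1 (fun t => K * expR (- mu * (t - a)))
    (- mu * (K * expR (- mu * (t - a)))).
Proof.
by apply: is_derive_eq; rewrite /GRing.scale/=; ring.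
Qed.

Lemma expR_decay_AC (R : realType) (K mu a b : R) :
  abs_continuous_on a b (fun t => K * expR (- mu * (t - a))).
Proof.
pose C := `|mu| * (`|K| * expR (`|mu| * (b - a))).
apply: (@lipschitz_AC _ _ _ _ C).
apply: (MVT_lipschitz (df := fun t => - mu * (K * expR (- mu * (t - a))))).
- apply: derivable_within_continuous => t _.
  by have [] := expR_decay_is_derive K mu a t.
- move=> t tab; split; first exact: expR_decay_is_derive.
  rewrite normrM normrN ler_wpM2l// normrM ler_wpM2l//.
  rewrite (ger0_norm (expR_ge0 _)) ler_expR; apply: le_trans (ler_norm _) _.
  rewrite normrM normrN ler_wpM2l//.
  by rewrite ger0_norm; lra.
Qed.

Lemma AC_within_continuous (R : realType) (f : R -> R) (a b : R) :
  abs_continuous_on a b f -> {within `[a, b]%classic, continuous f}.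
Proof.
move=> acf; apply/subspace_continuousP => x /=; rewrite in_itv/= => /andP[ax xb].
apply/cvgrPdist_lt => e e0; have [d d0 fd] := acf _ e0.
have key s t : a <= s -> s <= t -> t <= b -> t - s < d -> `|f t - f s| < e.
  move=> as_ st tb tsd.
  have := fd 1%N (fun=> s) (fun=> t); rewrite !big_ord1; apply=> //.
  by apply/trivIsetP => i j _ _; rewrite (ord1 i) (ord1 j).
rewrite near_withinE; apply/nbhs_ballP; exists d => // t; rewrite /ball/= in_itv/=.
move=> xtd /andP[at_ tb]; have [xt|tx] := leP x t.
  by rewrite distrC; apply: key => //; rewrite distrC ger0_norm in xtd; lra.
by apply: key => //; [exact: ltW|rewrite ger0_norm in xtd; lra].
Qed.

Lemma AC_bounded (R : realType) (f : R -> R) (a b : R) :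
  a <= b -> abs_continuous_on a b f ->
  exists2 C : R, 0 <= C & forall t, a <= t <= b -> `|f t| <= C.
Proof.
move=> ab /AC_within_continuous cf.
have [c _ cmax] := EVT_max ab cf; have [c' _ cmin] := EVT_min ab cf.
exists (`|f c| + `|f c'|) => [|t tab]; first by rewrite addr_ge0.
have tI : t \in `[a, b]%R by rewrite in_itv.
have := cmax _ tI; have := cmin _ tI.
have := ler_norm (f c); have := ler_norm (- f c'); rewrite normrN.
have := normr_ge0 (f c); have := normr_ge0 (f c').
by move=> *; rewrite ler_norml; lra.
Qed.

Lemma ae_imply (R : realType) (P Q : R -> Prop) : (forall t, P t -> Q t) ->
  {ae @lebesgue_measure R, forall t, P t} ->
  {ae @lebesgue_measure R, forall t, Q t}.
Proof. by move=> PQ; apply: negligibleS; apply: subsetC => t; exact: PQ. Qed.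

Lemma ae_and (R : realType) (P Q : R -> Prop) :
  {ae @lebesgue_measure R, forall t, P t} ->
  {ae @lebesgue_measure R, forall t, Q t} ->
  {ae @lebesgue_measure R, forall t, P t /\ Q t}.
Proof.
move=> aP aQ; have := negligibleU aP aQ; apply: negligibleS.
by rewrite -setCI; apply: subsetC.
Qed.

Lemma is_derive1_derivable (R : realType) (f : R -> R) (t : R) :
  derivable f t 1 -> is_derive t 1 f (derive1 f t).
Proof. by move=> df; rewrite derive1E; exact: derivableP. Qed.

Lemma AC_N (R : realType) (f : R -> R) (a b : R) :
  abs_continuous_on a b f -> abs_continuous_on a b (fun t => - f t).
Proof.
move=> acf; apply: (AC_dominated acf acf ltr01) => s t _ _ _.
by rewrite -opprD normrN mul1r lerDl.
Qed.

(** [AC_increment_le] for [f] and for [- f] gives the two sides. *)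
Lemma AC_lipschitz (R : realType) (f : R -> R) (a b L : R) : 0 <= L ->
  abs_continuous_on a b f ->
  {ae @lebesgue_measure R, forall t, a < t < b ->
    derivable f t 1 /\ `|derive1 f t| <= L} ->
  forall s t, a <= s -> s <= t -> t <= b -> `|f t - f s| <= L * (t - s).
Proof.
move=> L0 acf df s t as_ st tb.
have acs := AC_subitv as_ tb acf.
rewrite ler_norml; apply/andP; split; last first.
  apply: AC_increment_le => //; apply: ae_imply df => c dfc sct.
  have [d1 d2] : derivable f c 1 /\ `|derive1 f c| <= L by apply: dfc; lra.
  apply: slope_le_is_derive (is_derive1_derivable d1) _.
  exact: le_trans (ler_norm _) d2.
have : (- f t) - (- f s) <= L * (t - s); last by lra.
apply: (AC_increment_le (f := fun t => - f t)) => //; first exact: AC_N.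
apply: ae_imply df => c dfc sct.
have [d1 d2] : derivable f c 1 /\ `|derive1 f c| <= L by apply: dfc; lra.
have dN := is_deriveN (is_derive1_derivable d1).
apply: slope_le_is_derive dN _.
by apply: le_trans (ler_norm _) _; rewrite normrN.
Qed.

(** * Exponential barriers and iteration of bounds *)

Lemma derivable_cvg (R : realType) (f : R -> R) (t : R) :
  derivable f t 1 -> f x @[x --> t] --> f t.
Proof. by move=> /derivable1_diffP/differentiable_continuous. Qed.

(* At a crossing y = Y of the barrier Y = K e^(-mu (t - a)) the equation forces
   (y - Y)' <= 0, so the positive part of y - Y has nonpositive slope a.e. *)
Lemma barrier_le (R : realType) (a b K mu : R) (y p : R -> R) : a <= b ->
  abs_continuous_on a b y -> y a <= K ->
  {ae @lebesgue_measure R, forall t, a < t < b ->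
    [/\ derivable y t 1, 0 <= p t
      & derive1 y t + p t * y t <= (p t - mu) * (K * expR (- mu * (t - a)))]} ->
  y b <= K * expR (- mu * (b - a)).
Proof.
move=> ab acy ya dy; pose Y t := K * expR (- mu * (t - a)).
have YK : Y a = K by rewrite /Y subrr mulr0 expR0 mulr1.
pose z t := Num.max (y t - Y t) 0.
have acz : abs_continuous_on a b z.
  apply: (AC_dominated acy (expR_decay_AC K mu a b) ltr01) => s t _ _ _.
  rewrite mul1r -/(Y s) -/(Y t); apply: le_trans (ler_normB _ _).
  have -> : y t - y s - (Y t - Y s) = (y t - Y t) - (y s - Y s) by ring.
  rewrite /z; set A := y t - Y t; set B := y s - Y s.
  have := ler_norm (A - B); have := ler_norm (- (A - B)); rewrite normrN.
  by case: (leP A 0) => ?; case: (leP B 0) => ? ? ?; rewrite ler_norml; lra.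
have za : z a = 0 by rewrite /z YK; apply/max_idPr; rewrite subr_le0.
suff : z b - z a <= 0 * (b - a).
  by rewrite mul0r za subr0 /z ge_max lexx andbT subr_le0.
apply: AC_increment_le => //; apply: ae_imply dy => c dyc acb e e0.
have {dyc}[dy pc yc] := dyc acb.
have dY : is_derive c 1 (fun t => y t - Y t) (derive1 y c - (- mu * Y c)).
  apply: is_deriveB; first exact: is_derive1_derivable.
  exact: expR_decay_is_derive.
(* On or above the barrier the slope bound of [y - Y] passes to its positive part; strictly below
   it, the positive part vanishes near [c] by continuity. *)
have [yYc|yYc] := leP (Y c) (y c).
  have sl : slope_le (fun t => y t - Y t) 0 c.
    apply: slope_le_is_derive dY _.
    have : 0 <= p c * (y c - Y c) by rewrite mulr_ge0// subr_ge0.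
    by move: yc; rewrite -/(Y c); lra.
  have [d d0 yd] := sl _ e0; exists d => // t tcd; have [r l] := yd _ tcd.
  have zc : z c = y c - Y c by apply/max_idPl; rewrite subr_ge0.
  have zt : z t = y t - Y t \/ (z t = 0 /\ y t - Y t <= 0).
    by rewrite /z; case: (leP (y t - Y t) 0) => ?; [right|left].
  split=> ct.
    have : 0 <= (0 + e) * (t - c) by rewrite add0r mulr_ge0 ?subr_ge0// ltW.
    by have := r ct; case: zt => [->|[-> ?]]; rewrite zc; lra.
  by have := l ct; case: zt => [->|[-> ?]]; rewrite zc; lra.
have /cvgrPdist_lt : (fun t => y t - Y t) x @[x --> c] --> y c - Y c.
  by apply: (derivable_cvg (f := fun t => y t - Y t)); have [] := dY.
have e1 : 0 < Y c - y c by rewrite subr_gt0.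
move=> /(_ _ e1)[d /= d0 yd]; exists d => // t tcd.
have z0 x : y x - Y x <= 0 -> z x = 0 by move=> h; apply/max_idPr.
have ct : `|c - t| < d by rewrite distrC.
have /= := yd _ ct; rewrite ltr_norml => /andP[h1 h2].
have {h1}zt : z t = 0 by apply: z0; move: h1; clear -yYc; lra.
have zc : z c = 0 by apply: z0; clear -yYc; lra.
rewrite zt zc subrr add0r.
by split=> ?; rewrite mulr_ge0 ?subr_ge0// ltW.
Qed.

(** [barrier_le] for [y] and [- y]. A negative [mu] gives an increasing barrier, which is how
    [growth_bound] uses it. *)
Lemma barrier (R : realType) (a b K mu : R) (y p : R -> R) :
  abs_continuous_on a b y -> `|y a| <= K ->
  {ae @lebesgue_measure R, forall t, a < t < b ->
    [/\ derivable y t 1, 0 <= p t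
      & `|derive1 y t + p t * y t| <=
        (p t - mu) * (K * expR (- mu * (t - a)))]} ->
  forall t, a <= t <= b -> `|y t| <= K * expR (- mu * (t - a)).
Proof.
move=> acy ya dy t /andP[at_ tb].
have act := AC_subitv (lexx a) tb acy.
rewrite ler_norml; apply/andP; split; last first.
  apply: (barrier_le (p := p)) => //; first exact: le_trans (ler_norm _) ya.
  apply: ae_imply dy => c dyc act'.
  have [|? ? yc] := dyc; first lra; split => //.
  exact: le_trans (ler_norm _) yc.
rewrite lerNl; apply: (barrier_le (y := fun t => - y t) (p := p)) => //.
- exact: AC_N.
- by apply: le_trans (ler_norm _) _; rewrite normrN.
- apply: ae_imply dy => c dyc act'.
  have [|d1 ? yc] := dyc; first lra.
  have [dN yN] := is_deriveN (is_derive1_derivable d1).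
  split => //.
  have -> : derive1 (fun t => - y t) c = - derive1 y c by rewrite derive1E.
  apply: le_trans yc; rewrite mulrN -opprD.
  by apply: le_trans (ler_norm _) _; rewrite normrN.
Qed.

(** Iterating [step] from [k] gives the bounds max(c, th^n k), and th^n k drops below [c] because
    th^n tends to 0. The size of the initial [k] leaves no trace in the result. *)
Lemma contraction_bound (R : realType) (P : R -> Prop) (c th : R) :
  0 < c -> 0 <= th -> th < 1 ->
  (forall k, 0 < k -> P k -> P (Num.max c (th * k))) ->
  (exists2 k, 0 < k & P k) -> P c.
Proof.
move=> c0 th0 th1 step [k k0 Pk].
have Pn n : P (Num.max c (th ^+ n * k)) \/ P c.
  elim: n => [|n [IH|Pc]]; last by right.
  - have [ck|kc] := leP c k.
      by left; rewrite expr0 mul1r (max_idPr ck).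
    right; have thkc : th * k <= c.
      by apply: le_trans (ltW kc); rewrite ler_piMl// ltW.
    by rewrite -(max_idPl thkc); exact: step.
  - have := IH; have [cn|nc] := leP c (th ^+ n * k); last by right.
    move=> Pkn; left; rewrite exprS -mulrA; apply: step => //.
    exact: lt_le_trans cn.
have : th ^+ n @[n --> \oo] --> (0 : R) by apply: cvg_expr; rewrite ger0_norm.
have ck0 : 0 < c / k by rewrite divr_gt0.
move=> /cvgrPdist_lt/(_ _ ck0)[n _ /(_ n (leqnn n))] /=.
rewrite sub0r normrN ger0_norm ?exprn_ge0// ltr_pdivlMr// => thn.
by have [|//] := Pn n; rewrite (max_idPl (ltW thn)).
Qed.

(** * Positive vectors d with A d < d for a nonnegative matrix A *)

Section comparison_vector.
Variables (R : realType) (n : nat) (A : 'M[R]_n).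
Hypothesis A0 : forall i j, 0 <= A i j.

(** A Collatz-Wielandt vector: for a nonnegative matrix of positive size it certifies that the
    spectral radius is below [t]. *)
Definition strict_supervector (t : R) (d : 'I_n -> R) :=
  (forall i, 0 < d i) /\ forall i, \sum_j A i j * d j < t * d i.

(** A maximum principle. Let [i] minimise [y i / d i]; if this minimum c were negative, then (A y)_i
    >= c (A d)_i > t c d_i = t y_i. *)
Lemma supervector_nonneg t d y : strict_supervector t d ->
  (forall i, \sum_j A i j * y j <= t * y i) -> forall i, 0 <= y i.
Proof.
move=> [d0 Ad] Ay i0; rewrite leNgt; apply/negP => yi0.
have [i _ imin] := @arg_minP _ R _ i0 xpredT (fun i => y i / d i) isT.
have yi : y i < 0.
  have := imin i0 isT; rewrite ler_pdivlMr// => /le_lt_trans /(_ yi0).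
  by rewrite pmulr_llt0// pmulr_llt0// invr_gt0.
have ydi : 0 < - (y i / d i) by rewrite oppr_gt0 pmulr_llt0// invr_gt0.
have : \sum_j A i j * (y i / d i * d j) <= \sum_j A i j * y j.
  apply: ler_sum => j _; rewrite ler_wpM2l//.
  by have := imin j isT; rewrite ler_pdivlMr.
have -> : \sum_j A i j * (y i / d i * d j) = y i / d i * \sum_j A i j * d j.
  by rewrite mulr_sumr; apply: eq_bigr => j _; ring.
have := Ad i; rewrite -(ltr_pM2l ydi) => lt1 le1.
have := le_trans le1 (Ay i).
have -> : t * y i = y i / d i * (t * d i) by field; rewrite gt_eqF.
by move: lt1; rewrite !mulNr ltrN2 => /lt_le_trans h /h; rewrite ltxx.
Qed.

Lemma resolvent_one (t : R) : t%:M - A \in unitmx ->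
  exists y : 'I_n -> R, forall i, \sum_j A i j * y j = t * y i - 1.
Proof.
move=> U.
have [Y /matrixP YE] : exists Y : 'cV[R]_n, (t%:M - A) *m Y = const_mx 1.
  by exists (invmx (t%:M - A) *m const_mx 1); rewrite mulKVmx.
exists (fun i => Y i 0) => i; have := YE i 0.
by rewrite mulmxBl mul_scalar_mx !mxE => <-; ring.
Qed.

(** Strict positivity comes from t y = 1 + A y >= 1. *)
Lemma resolvent_supervector t y : 0 < t -> (forall i, 0 <= y i) ->
  (forall i, \sum_j A i j * y j = t * y i - 1) -> strict_supervector t y.
Proof.
move=> t0 y0 Ay; split=> i; last by rewrite Ay gtrBl.
have : 0 <= \sum_j A i j * y j by apply: sumr_ge0 => j _; rewrite mulr_ge0.
by rewrite Ay subr_ge0 => h; rewrite -(pmulr_rgt0 _ t0); apply: lt_le_trans h.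
Qed.

(** The vector is the inverse of I - A applied to the constant vector 1. *)
Lemma M_matrix_supervector : nonsingular_M_matrix (1%:M - A) ->
  exists d, strict_supervector 1 d.
Proof.
move=> [_ U inv0]; have [Y [/matrixP YE Y0]] : exists Y : 'cV[R]_n,
    (1%:M - A) *m Y = const_mx 1 /\ forall i, 0 <= Y i 0.
  exists (invmx (1%:M - A) *m const_mx 1); rewrite mulKVmx//; split=> // i.
  by rewrite mxE; apply: sumr_ge0 => j _; rewrite mxE mulr1.
exists (fun i => Y i 0); apply: resolvent_supervector => // i.
have := YE i 0.
by rewrite mulmxBl mul1mx !mxE mul1r => <-; ring.
Qed.

Lemma not_unit_eigenvalue (t : R) : t%:M - A \notin unitmx -> eigenvalue A t.
Proof.
rewrite unitmxE unitfE negbK => /det0P[v v0 vA]; apply/eigenvalueP; exists v => //.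
by move: vA; rewrite mulmxBr mul_mx_scalar => /eqP; rewrite subr_eq0 => /eqP.
Qed.

Lemma spectral_radius_ge (t : R) : 0 <= t -> eigenvalue A t ->
  t <= spectral_radius A.
Proof.
move=> t0 tA; apply: ub_le_sup => /=; last first.
  exists (real_complex R t); first by rewrite /= eigenvalue_map.
  by rewrite /= expr0n addr0 sqrtr_sqr ger0_norm.
(* The supremum is meaningful only for a bounded set: the eigenvalues are among the finitely many
   roots [rs], so the sum of all the moduli bounds each of them. *)
pose p := char_poly (map_mx (real_complex R) A).
have [rs prs] := closed_field_poly_normal p.
exists (\sum_(r <- rs) complex.Re `|r|) => _ [z zA <-].
have zrs : z \in rs.
  move: zA; rewrite /= eigenvalue_root_char -/p prs.
  by rewrite (monicP (char_poly_monic _)) scale1r root_prod_XsubC.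
rewrite (big_rem z)//= lerDl; apply: sumr_ge0 => r _.
by have := normr_ge0 r; rewrite lecE => /andP[].
Qed.

Lemma strict_supervectorW s t d : s <= t ->
  strict_supervector s d -> strict_supervector t d.
Proof.
move=> st [d0 Ad]; split => // i; apply: lt_le_trans (Ad i) _.
by rewrite ler_pM2r.
Qed.

(* Let t be the least number from which on the supervectors exist. If t >= 1 it
   is no eigenvalue, and (t - A)^-1 1 is a supervector of some t' < t. *)
Lemma spectral_radius_supervector : spectral_radius A < 1 ->
  exists d, strict_supervector 1 d.
Proof.
move=> rho1; apply: contrapT => no1.
pose S : set R := [set t | exists d, strict_supervector t d].
have lbS : lbound S 1.
  move=> t [d Sd]; rewrite leNgt; apply/negP => t1; apply: no1; exists d.
  exact: strict_supervectorW (ltW t1) Sd.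
have S0 : S !=set0.
  (* For the constant vector 1, any number above all the row sums will do. *)
  exists (1 + \sum_i \sum_j A i j), (fun=> 1); split=> // i; rewrite mulr1.
  under eq_bigr do rewrite mulr1.
  rewrite [X in _ < 1 + X](bigD1 i)//=.
  have : 0 <= \sum_(k | k != i) \sum_j A k j.
    by apply: sumr_ge0 => k _; exact: sumr_ge0.
  by lra.
have hS : has_inf S by split => //; exists 1.
have t1 : 1 <= inf S by exact: lb_le_inf.
set t := inf S in t1.
have t0 : 0 < t by lra.
have U : t%:M - A \in unitmx.
  apply/negPn/negP => /not_unit_eigenvalue /(spectral_radius_ge (ltW t0)) rt.
  by lra.
have [y Ay] := resolvent_one U.
(* Moving [t] by [D^-1] changes each [t * y i] by less than 1. Upwards, this makes
   [supervector_nonneg] applicable to [y] with some [s] of [S] near [t], so [y] is nonnegative;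
   downwards, it makes [y] a supervector for [t - D^-1], against the choice of [t]. *)
pose D := 1 + \sum_i `|y i|.
have yD i : `|y i| < D.
  rewrite /D (bigD1 i)//= addrCA ltrDl addrC.
  by rewrite ltr_wpDl// sumr_ge0.
have D0 : 0 < D by rewrite /D ltr_pwDl// sumr_ge0.
have iD0 : 0 < D^-1 by rewrite invr_gt0.
have [s [d Sd] st] := inf_adherent iD0 hS.
have ts : t <= s by apply: ge_inf; [exists 1|exists d].
have y0 : forall i, 0 <= y i.
  apply: supervector_nonneg Sd _ => i; rewrite Ay.
  have : `|(s - t) * y i| <= 1.
    rewrite normrM ger0_norm ?subr_ge0//.
    apply: (@le_trans _ _ (D^-1 * D)); last by rewrite mulVf// gt_eqF.
    apply: ler_pM; rewrite ?subr_ge0// ?(ltW (yD _))//.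
    by move: st; rewrite -/t; lra.
  by rewrite ler_norml => /andP[]; lra.
have [y1 _] := resolvent_supervector t0 y0 Ay.
have : S (t - D^-1).
  exists y; split => // i; rewrite Ay mulrBl ltrD2l ltrN2.
  by rewrite mulrC ltr_pdivrMr// mul1r; apply: le_lt_trans (yD i); exact: ler_norm.
by move=> /(ge_inf (ex_intro _ 1 lbS)); rewrite -/t; lra.
Qed.

(** [eta] is the largest of the finitely many ratios (A d)_i / d_i, each of which is below 1. *)
Lemma comparison_vector :
  spectral_radius A < 1 \/ nonsingular_M_matrix (1%:M - A) ->
  exists (d : 'I_n -> R) (eta : R), [/\ forall i, 0 < d i, 0 <= eta < 1
    & forall i, \sum_j A i j * d j <= eta * d i].
Proof.
move=> hA; have [d [d0 Ad]] : exists d, strict_supervector 1 d.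
  by case: hA; [exact: spectral_radius_supervector|exact: M_matrix_supervector].
pose r i := (\sum_j A i j * d j) / d i.
exists d, (\big[Num.max/0]_i r i); split => //.
  apply/andP; split; first exact: bigmax_ge_id.
  apply: bigmax_lt => // i _; rewrite /r ltr_pdivrMr//; exact: Ad.
by move=> i; rewrite -ler_pdivrMr//; exact: (le_bigmax _ r).
Qed.

End comparison_vector.

(** * Essential norms and the rows of the comparison matrix *)

(** For a null measure every essential supremum would be -oo; positivity of the measure makes that
    of a nonnegative function nonnegative. *)
Lemma half_line_measure_gt0 (R : realType) (t0 : R) :
  (0 < mrestr (@lebesgue_measure R) (measurable_itv `[t0, +oo[%R) setT)%E.
Proof.
suff : (0 < @lebesgue_measure R (setT `&` `[t0, +oo[%classic))%E by [].
by rewrite setTI lebesgue_measure_itv/= ltry addye// ltry.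
Qed.

Lemma ess_norm_ge0 (R : realType) (t0 : R) (y : R -> R) : 0 <= ess_norm t0 y.
Proof.
apply: fine_ge0; apply: ess_sup_gee; first exact: half_line_measure_gt0.
by apply: aeW => t; rewrite /= lee_fin normr_ge0.
Qed.

(** The bound [C] makes the essential supremum finite, so that [fine] does not return its default
    value 0. *)
Lemma ess_norm_ae_le (R : realType) (t0 C : R) (y : R -> R) :
  (forall t, t0 <= t -> `|y t| <= C) ->
  {ae @lebesgue_measure R, forall t, t0 <= t -> `|y t| <= ess_norm t0 y}.
Proof.
move=> yC; rewrite /ess_norm.
set mu := mrestr _ _; set f := (fun t => (`|y t|)%:E); set e := ess_sup mu f.
have e0 : (0 <= e)%E.
  apply: ess_sup_gee; first exact: half_line_measure_gt0.
  by apply: aeW => t; rewrite /= lee_fin normr_ge0.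
have eC : (e <= C%:E)%E.
  apply/ess_supP; exists (~` `[t0, +oo[%classic); split.
  - by apply: measurableC; exact: measurable_itv.
  - suff : @lebesgue_measure R
        (~` `[t0, +oo[%classic `&` `[t0, +oo[%classic) = 0%E by [].
    by rewrite setICl measure0.
  - apply: subsetC => t /=; rewrite in_itv/= andbT => t0t.
    by rewrite lee_fin yC.
have efin : (fine e)%:E = e.
  by rewrite fineK// ge0_fin_numE// (le_lt_trans eC)// ltry.
have [N [mN N0 fN]] := ess_sup_ge mu f.
(* [N] is null for the restricted measure, hence only its part in the half-line is Lebesgue null. *)
exists (N `&` `[t0, +oo[%classic); split.
- by apply: measurableI => //; exact: measurable_itv.
- exact: N0.
move=> t /= /not_implyP[t0t yt]; split; last by rewrite /= in_itv/= andbT.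
by apply: fN => /=; rewrite -/e -efin lee_fin.
Qed.

(** The weights [d1], ..., [d5] belong to x, x', x'', u, u' in this order. Nonnegative delay bounds
    make the matrix nonnegative. *)
Lemma comparison_matrix_rows (R : realType) (S : delay_system R) (t0 : R)
    (N := ess_norm t0) (Q := fun y z => ess_norm t0 (fun t => y t / z t)) :
  0 <= tau1 S -> 0 <= tau2 S -> 0 <= sigma1 S ->
  spectral_radius (comparison_matrix S t0) < 1 \/
  nonsingular_M_matrix (1%:M - comparison_matrix S t0) ->
  exists (d1 d2 d3 d4 d5 eta : R),
    [/\ 0 < d1, 0 < d2, 0 < d3, 0 < d4 & 0 < d5] /\ 0 <= eta < 1 /\
    [/\ tau2 S * d2 + tau1 S * Q (a1 S) (a2 S) * d3 + Q (a3 S) (a2 S) * d4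
          <= eta * d1,
        Q (a2 S) (a1 S) * d1 + tau1 S * d3 + Q (a3 S) (a1 S) * d4 <= eta * d2,
        N (a2 S) * d1 + N (a1 S) * d2 + N (a3 S) * d4 <= eta * d3,
        Q (b2 S) (b1 S) * d1 + sigma1 S * d5 <= eta * d4
      & N (b2 S) * d1 + N (b1 S) * d4 <= eta * d5].
Proof.
move=> tau1_0 tau2_0 sigma1_0 hA.
have A0 i j : 0 <= comparison_matrix S t0 i j.
  rewrite mxE; case: i => [[|[|[|[|[|//]]]]] ?];
  case: j => [[|[|[|[|[|//]]]]] ?] //=;
  by rewrite ?mulr_ge0// ess_norm_ge0.
have [d [eta [d0 eta01 Ad]]] := comparison_vector A0 hA.
pose o k : 'I_5 := inord k.
exists (d (o 0%N)), (d (o 1%N)), (d (o 2%N)), (d (o 3%N)), (d (o 4%N)), eta.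
split; first by split; exact: d0.
split => //.
have row i : \sum_j comparison_matrix S t0 (o i) j * d j =
  \sum_(j < 5) comparison_matrix S t0 (o i) (o j) * d (o j).
  by apply: eq_bigr => j _; rewrite /o inord_val.
have rowle i := Ad (o i).
split; [have := rowle 0%N|have := rowle 1%N|have := rowle 2%N|have := rowle 3%N
  |have := rowle 4%N];
  rewrite row !big_ord_recr big_ord0/= !mxE !inordK//=; rewrite /N /Q; lra.
Qed.

(** * Solutions as trajectories, and bounds on delays and coefficients *)

(** The velocity [v] is a separate function, since on the history it is prescribed independently of
    [x]; it is tied to [x] only after [s]. *)
Record trajectory (R : realType) (S : delay_system R) (s : R) (x v u : R -> R)
    : Prop := Trajectory {
  position_derive : forall t, s < t -> is_derive t 1 x (v t);
  position_AC : loc_abs_continuous_from s x;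
  velocity_AC : loc_abs_continuous_from s v;
  control_AC : loc_abs_continuous_from s u;
  velocity_equation : {ae @lebesgue_measure R, forall t, s < t ->
    derivable v t 1 /\
    derive1 v t = - (a1 S t * v (h1 S t) + a2 S t * x (h2 S t)
                     + a3 S t * u (h3 S t))};
  control_equation : {ae @lebesgue_measure R, forall t, s < t ->
    derivable u t 1 /\
    derive1 u t = - (b1 S t * u (g1 S t) + b2 S t * x (g2 S t))} }.

(** Near [s] the right difference quotient is at most [|l| + 1] in modulus, so x t - x s is at most
    that constant times t - s. *)
Lemma cvg_right_of_derivative (R : realType) (x : R -> R) (s l : R) :
  h^-1 * (x (s + h) - x s) @[h --> 0^'+] --> l -> x t @[t --> s^'+] --> x s.
Proof.
move=> /cvgrPdist_lt /(_ _ ltr01)[d /= d0 qd].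
apply/cvgrPdist_lt => e e0; pose c := `|l| + 1.
have c0 : 0 < c by rewrite ltr_wpDl.
rewrite near_withinE; apply/nbhs_ballP; exists (Num.min d (e / c)).
  by rewrite /= lt_min d0 divr_gt0.
move=> t; rewrite /ball/= lt_min => /andP[std ste] st.
have ts0 : 0 < t - s by rewrite subr_gt0.
have tsE : `|s - t| = t - s by rewrite distrC gtr0_norm.
have := qd (t - s); rewrite /= sub0r normrN gtr0_norm// -{1}tsE => /(_ std ts0).
rewrite [s + _]addrC subrK => q1.
have qc : `|(t - s)^-1 * (x t - x s)| < c.
  rewrite -[X in `|X|](subrK l) (le_lt_trans (ler_normD _ _))// /c addrC.
  by rewrite ltrD2l distrC.
move: qc; rewrite normrM gtr0_norm ?invr_gt0// mulrC ltr_pdivrMr// => xc.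
rewrite distrC (lt_trans xc)//.
by move: ste; rewrite tsE ltr_pdivlMr// mulrC.
Qed.

(** The point is the absolute continuity of [x]: on [[s, T]] its derivative is bounded, being
    absolutely continuous, and [x] is right-continuous at [s], so the mean value theorem makes it
    Lipschitz. *)
Lemma solution_trajectory (R : realType) (S : delay_system R) (s : R)
    (phi1 phi2 psi x u : R -> R) :
  is_solution S s phi1 phi2 psi x u -> trajectory S s x (xdot s phi2 x) u.
Proof.
move=> [_ [dx xs] [acv acu] eqv equ].
have dxv t : s < t -> is_derive t 1 x (xdot s phi2 x t).
  by move=> st; rewrite /xdot leNgt st/=; exact/is_derive1_derivable/dx.
split => //.
- move=> T; rewrite le_eqVlt => /predU1P[->|sT].
    apply: (@lipschitz_AC _ _ _ _ 0) => p q Tp pq qT.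
    have -> : q = p by apply/le_anti; rewrite pq (le_trans qT Tp).
    by rewrite !subrr normr0 mulr0.
  have [C C0 vC] := AC_bounded (ltW sT) (acv _ (ltW sT)).
  apply: (@lipschitz_AC _ _ _ _ C); apply: MVT_lipschitz; last first.
    by move=> t /andP[st tT]; split; [exact: dxv|apply: vC; rewrite !ltW].
  apply/continuous_within_itvP => //; split.
  + by move=> t; rewrite in_itv/= => /andP[st _]; exact/derivable_cvg/dx.
  + exact: cvg_right_of_derivative xs.
  + by apply: cvg_at_left_filter; exact/derivable_cvg/dx.
- apply: ae_imply eqv => t eqv st; have [dv e] := eqv st; split => //.
  by move: e; lra.
- apply: ae_imply equ => t equ st; have [du e] := equ st; split => //.
  by move: e; lra.
Qed.

Lemma ler_norm_mul (R : realDomainType) (a y A Y : R) :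
  `|a| <= A -> `|y| <= Y -> `|a * y| <= A * Y.
Proof. by move=> aA yY; rewrite normrM ler_pM. Qed.

Section delays.
Variables (R : realType) (S : delay_system R).
Hypothesis hS : standing_assumptions S.

Lemma delay_bounds (t : R) : 0 <= t ->
  [/\ t - max_delay S <= h1 S t <= t, t - max_delay S <= h2 S t <= t,
      t - max_delay S <= h3 S t <= t, t - max_delay S <= g1 S t <= t
    & t - max_delay S <= g2 S t <= t].
Proof.
case: hS => _ [_ [[[_ H1] [_ H2] [_ H3]] [[_ G1] [_ G2]]]] t0.
have := H1 _ t0; have := H2 _ t0; have := H3 _ t0; have := G1 _ t0.
have := G2 _ t0.
have r1 : tau1 S <= max_delay S by rewrite /max_delay !le_max lexx.
have r2 : tau2 S <= max_delay S by rewrite /max_delay !le_max lexx !orbT.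
have r3 : tau3 S <= max_delay S by rewrite /max_delay !le_max lexx !orbT.
have r4 : sigma1 S <= max_delay S by rewrite /max_delay !le_max lexx !orbT.
have r5 : sigma2 S <= max_delay S by rewrite /max_delay !le_max lexx !orbT.
by split; lra.
Qed.

Lemma max_delay_ge0 : 0 <= max_delay S.
Proof. by have [] := delay_bounds (lexx 0); lra. Qed.

Lemma coefficients_bounded : exists2 c : R, 0 <= c &
  {ae @lebesgue_measure R, forall t, 0 <= t ->
    [/\ `|a1 S t| <= c, `|a2 S t| <= c, `|a3 S t| <= c, `|b1 S t| <= c
      & `|b2 S t| <= c]}.
Proof.
case: hS => [[[_ [c1 C1]] [_ [c2 C2]] [_ [c3 C3]]] [[[_ [c4 C4]] [_ [c5 C5]]] _]].
exists (`|c1| + `|c2| + `|c3| + `|c4| + `|c5|); first by rewrite !addr_ge0.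
apply: ae_imply (ae_and C1 (ae_and C2 (ae_and C3 (ae_and C4 C5)))).
move=> t [A1 [A2 [A3 [A4 A5]]]] t0.
have I : `[0, +oo[%classic t by rewrite /= in_itv/= andbT.
have le (c y : R) : `|y| <= c -> `|y| <= `|c|
  by move=> /le_trans; apply; exact: ler_norm.
have := normr_ge0 c1; have := normr_ge0 c2; have := normr_ge0 c3.
have := normr_ge0 c4; have := normr_ge0 c5.
split; [have := le _ _ (A1 I)|have := le _ _ (A2 I)|have := le _ _ (A3 I)
  |have := le _ _ (A4 I)|have := le _ _ (A5 I)]; lra.
Qed.

End delays.

(** * Growth on a time interval of fixed length *)

Section growth.
Variables (R : realType) (S : delay_system R).
Hypothesis hS : standing_assumptions S.

(** [C] is chosen before [s] and the solution, which gives uniformity in the initial point. The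
    bound k e^(kap (t - s)) improves to max(N, k / 2) e^(kap (t - s)) by comparison with an
    increasing barrier. *)
Lemma growth_bound (L : R) : 0 <= L -> exists2 C : R, 1 <= C &
  forall (s : R) (x v u : R -> R) (N : R), 0 <= s -> 0 < N -> trajectory S s x v u ->
    (forall t, history S s t -> [/\ `|x t| <= N, `|v t| <= N & `|u t| <= N]) ->
    forall t : R, s <= t <= s + L -> [/\ `|x t| <= C * N, `|v t| <= C * N
      & `|u t| <= C * N].
Proof.
move=> L0; have [c c0 coefs] := coefficients_bounded hS.
(* With [k <= 2 * K] the derivatives of x, v, u are at most 2 K, 6 c K and 4 c K times the
   exponential, all within [kap * K] times it. *)
pose kap : R := 2 * (3 * c + 1).
exists (expR (kap * L)).
  by rewrite -[leLHS]expR0 ler_expR mulr_ge0// /kap; lra.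
move=> s x v u N s0 N0 tr hist.
have [mu mukap] : exists mu : R, kap = - mu by exists (- kap); rewrite opprK.
have mu0 : 0 - mu = kap by rewrite sub0r.
pose E t := expR (- mu * (t - s)).
have kap0 : 0 <= kap by rewrite /kap; lra.
have E0 t : 0 < E t by exact: expR_gt0.
have Emono (p q : R) : p <= q -> E p <= E q.
  by move=> pq; rewrite ler_expR -mukap ler_wpM2l// lerD2r.
have E1 (t : R) : s <= t -> 1 <= E t.
  by move=> st; rewrite -[leLHS]expR0 ler_expR -mukap mulr_ge0// subr_ge0.
pose P (k : R) := forall t : R, s <= t <= s + L ->
  [/\ `|x t| <= k * E t, `|v t| <= k * E t & `|u t| <= k * E t].
suff PN : P N.
  move=> t tI; have [xN vN uN] := PN t tI.
  have EL : N * E t <= expR (kap * L) * N.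
    rewrite mulrC ler_pM2r// ler_expR -mukap ler_wpM2l//; lra.
  by split; apply: le_trans EL.
have sL : s <= s + L by lra.
have acx := position_AC tr sL; have acv := velocity_AC tr sL.
have acu := control_AC tr sL.
apply: (@contraction_bound R P N (1 / 2)) => //; first by lra.
- move=> k k0 Pk; set K := Num.max N (1 / 2 * k).
  have NK : N <= K by rewrite /K le_max lexx.
  have kK : k <= 2 * K.
    by have : 1 / 2 * k <= K by [rewrite /K le_max lexx orbT]; lra.
  (* Before [s] the history bound applies and the exponential at [t] is at least 1; after [s] the
     exponential increases, so a delay costs nothing. *)
  have delayed (t t' : R) : s < t < s + L -> t - max_delay S <= t' <= t ->
      [/\ `|x t'| <= 2 * K * E t, `|v t'| <= 2 * K * E t
        & `|u t'| <= 2 * K * E t].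
    move=> sts /andP[tt' t't].
    have [t's|st'] := leP t' s.
      have NE : N <= 2 * K * E t.
        have h1 : 1 <= E t by apply: E1; lra.
        have h2 : 2 * K * 1 <= 2 * K * E t by rewrite ler_wpM2l//; lra.
        by lra.
      have [|h1 h2 h3] := hist t'.
        by rewrite /history /= in_itv/=; lra.
      by split; apply: le_trans NE.
    have kE : k * E t' <= 2 * K * E t.
      by apply: ler_pM => //; [exact: ltW|exact: ltW|exact: Emono].
    have [|h1 h2 h3] := Pk t'; first by lra.
    by split; apply: le_trans kE.
  have KE0 t : 0 <= K * E t by apply: mulr_ge0; [lra|exact: ltW].
  have [hx hv hu] : [/\ `|x s| <= N, `|v s| <= N & `|u s| <= N].
    apply: hist; rewrite /history/= in_itv/= lexx andbT.
    by have := max_delay_ge0 hS; lra.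
  have Bx : forall t : R, s <= t <= s + L -> `|x t| <= K * E t.
    apply: (barrier (p := fun=> 0)) acx _ _; first exact: le_trans NK.
    apply: aeW => t sts; split => //.
      by have [] := position_derive tr (_ : s < t); first lra.
    rewrite mul0r addr0 mu0 derive1E.
    have [_ ->] : is_derive t 1 x (v t) by apply: (position_derive tr); lra.
    have [|_ + _] := Pk t; first by lra.
    move=> /le_trans; apply; rewrite -/(E t).
    apply: (@le_trans _ _ (2 * (K * E t))).
      by rewrite mulrA ler_pM2r.
    by apply: ler_wpM2r => //; rewrite /kap; lra.
  have Bv : forall t : R, s <= t <= s + L -> `|v t| <= K * E t.
    apply: (barrier (p := fun=> 0)) acv _ _; first exact: le_trans NK.
    apply: ae_imply (ae_and coefs (velocity_equation tr)) => t [coef eqv] sts.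
    have [|dv ->] := eqv; [lra|split => //].
    have [|A1 A2 A3 _ _] := coef; first lra.
    have [|H1 H2 H3 _ _] := delay_bounds hS (t := t); first lra.
    have [_ V _] := delayed _ _ sts H1; have [X _ _] := delayed _ _ sts H2.
    have [_ _ U] := delayed _ _ sts H3.
    rewrite mul0r addr0 normrN mu0 -/(E t).
    apply: le_trans (ler_normD _ _) _.
    have := ler_normD (a1 S t * v (h1 S t)) (a2 S t * x (h2 S t)).
    have := ler_norm_mul A1 V; have := ler_norm_mul A2 X.
    have := ler_norm_mul A3 U; have := KE0 t; rewrite /kap.
    have -> : c * (2 * K * E t) = 2 * c * (K * E t) by ring.
    by lra.
  have Bu : forall t : R, s <= t <= s + L -> `|u t| <= K * E t.
    apply: (barrier (p := fun=> 0)) acu _ _; first exact: le_trans NK.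
    apply: ae_imply (ae_and coefs (control_equation tr)) => t [coef equ] sts.
    have [|du ->] := equ; [lra|split => //].
    have [|_ _ _ B1 B2] := coef; first lra.
    have [|_ _ _ G1 G2] := delay_bounds hS (t := t); first lra.
    have [_ _ U] := delayed _ _ sts G1; have [X _ _] := delayed _ _ sts G2.
    rewrite mul0r addr0 normrN mu0 -/(E t).
    apply: le_trans (ler_normD _ _) _.
    have := ler_norm_mul B1 U; have := ler_norm_mul B2 X; have := KE0 t.
    have : 0 <= c * (K * E t) by rewrite mulr_ge0.
    rewrite /kap; have -> : c * (2 * K * E t) = 2 * c * (K * E t) by ring.
    by lra.
  by move=> t ts; split; [exact: Bx|exact: Bv|exact: Bu].
(* The starting bound comes from compactness and may depend on the solution; the contraction removes
   it. *)
- have [Cx Cx0 xC] := AC_bounded sL acx.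
  have [Cv Cv0 vC] := AC_bounded sL acv; have [Cu Cu0 uC] := AC_bounded sL acu.
  exists (Cx + Cv + Cu + 1) => [|t ts]; first lra.
  have CE : Cx + Cv + Cu <= (Cx + Cv + Cu + 1) * E t.
    have : (Cx + Cv + Cu + 1) * 1 <= (Cx + Cv + Cu + 1) * E t.
      by rewrite ler_wpM2l ?E1//; lra.
    by lra.
  have := xC t ts; have := vC t ts; have := uC t ts.
  by split; lra.
Qed.

End growth.

(** * Choice of the decay rate, and forcing terms row by row *)

(** [mu] is the decay rate, [th] the contraction factor, and [sg] < 1 dominates [eta] enlarged by
    the two delay factors e^(mu r). The last four inequalities are what the barriers for x, x', u
    and x' + (alpha1 / 2) x require. *)
Lemma decay_parameters (R : realType) (alpha1 alpha2 beta1 A1 r eta : R) :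
  0 < alpha1 -> 0 < alpha2 -> 0 < beta1 -> alpha1 <= A1 -> 0 <= r ->
  0 <= eta < 1 ->
  exists mu th sg : R,
    [/\ 0 < mu, 8 * mu <= alpha1, mu <= beta1, 0 <= th < 1
      & expR (mu * r) ^+ 2 * eta <= sg] /\
    [/\ alpha1 / 2 - 2 * mu <= th * (alpha1 / 2 - mu),
        forall a, alpha1 <= a -> sg * a <= th * (a - mu),
        forall b, beta1 <= b -> sg * b <= th * (b - mu)
      & forall p a, 0 <= p <= A1 -> alpha2 <= a ->
        alpha1 / 2 * p - a + sg * a <= th * ((p - mu) * (alpha1 / 2 - 2 * mu))].
Proof.
move=> al1 al2 be1 alA r0 /andP[eta0 eta1].
have A10 : 0 < A1 by exact: lt_le_trans alA.
pose om : R := (1 - eta) / 2.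
have om0 : 0 < om by rewrite /om; lra.
have om1 : om <= 1 / 2 by rewrite /om; lra.
(* Each summand of [D] gives one of the smallness conditions [m1], [m2], [m3], [m4] on [mu]. *)
pose D : R := 4 * A1 / alpha2 + 8 / alpha1 + 2 / beta1 + 2 * r.
have D1 : 0 < 4 * A1 / alpha2 by rewrite divr_gt0// mulr_gt0.
have D2 : 0 < 8 / alpha1 by rewrite divr_gt0.
have D3 : 0 < 2 / beta1 by rewrite divr_gt0.
have D0 : 0 < D by rewrite /D; lra.
pose mu : R := om / D.
have mu0 : 0 < mu by rewrite divr_gt0.
have muD : mu * D = om by rewrite /mu mulfVK// gt_eqF.
have part c : c <= D -> mu * c <= om.
  by move=> cD; rewrite -muD ler_wpM2l// ltW.
have m1 : 4 * A1 * mu <= alpha2 * om.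
  have : mu * (4 * A1 / alpha2) <= om by apply: part; rewrite /D; lra.
  by rewrite mulrA ler_pdivrMr//; lra.
have m2 : 8 * mu <= alpha1 * om.
  have : mu * (8 / alpha1) <= om by apply: part; rewrite /D; lra.
  by rewrite mulrA ler_pdivrMr//; lra.
have m3 : 2 * mu <= beta1 * om.
  have : mu * (2 / beta1) <= om by apply: part; rewrite /D; lra.
  by rewrite mulrA ler_pdivrMr//; lra.
have m4 : 2 * (mu * r) <= om.
  by have := part (2 * r); rewrite mulrCA; apply; rewrite /D; lra.
have alom : alpha1 * om <= alpha1 * (1 / 2) by rewrite ler_wpM2l// ltW.
have beom : beta1 * om <= beta1 * (1 / 2) by rewrite ler_wpM2l// ltW.
(* With [th = 1 - del], the loss on a quantity of size at most [A1] is at most [mu]. *)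
pose del : R := mu / A1.
have del0 : 0 < del by rewrite divr_gt0.
have delA : del * A1 = mu by rewrite /del mulfVK// gt_eqF.
have del_om : del <= om / 8.
  rewrite /del ler_pdivrMr//.
  have : om * alpha1 <= om * A1 by rewrite ler_wpM2l// ltW.
  by lra.
have etaom : eta = 1 - 2 * om by rewrite /om; lra.
clearbody om; clear part D1 D2 D3; clearbody mu; clear muD D0; clearbody del.
exists mu, (1 - del), (1 - om); split; split.
- by [].
- lra.
- lra.
- lra.
(* By [m4], (1 - om) e^(-2 mu r) >= (1 - om)^2 >= 1 - 2 om = eta. *)
- have e1 : 1 - 2 * (mu * r) <= expR (- (2 * (mu * r))).
    exact: expR_ge1Dx.
  have e2 : expR (- (2 * (mu * r))) * expR (mu * r) ^+ 2 = 1.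
    by rewrite expr2 -!expRD -[RHS]expR0; congr expR; ring.
  have e3 : eta <= (1 - om) * (1 - 2 * (mu * r)).
    have : (1 - om) * (1 - om) <= (1 - om) * (1 - 2 * (mu * r)).
      by rewrite ler_wpM2l//; lra.
    have : 0 <= om * om by rewrite mulr_ge0// ltW.
    by lra.
  have e4 : eta <= (1 - om) * expR (- (2 * (mu * r))).
    by apply: le_trans e3 _; rewrite ler_wpM2l//; lra.
  rewrite [leLHS]mulrC (le_trans (ler_wpM2r _ e4)) ?exprn_ge0 ?expR_ge0//.
  by rewrite -mulrA e2 mulr1.
- have : del * (alpha1 / 2 - mu) <= del * A1 by rewrite ler_wpM2l//; lra.
  by lra.
- move=> a a1.
  have : om * alpha1 <= om * a by rewrite ler_wpM2l// ltW.
  have : del * a <= om / 8 * a by rewrite ler_wpM2r//; lra.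
  have : 0 <= del * mu by rewrite mulr_ge0// ltW.
  by lra.
- move=> b b1.
  have : om * beta1 <= om * b by rewrite ler_wpM2l// ltW.
  have : del * b <= om / 8 * b by rewrite ler_wpM2r//; lra.
  have : 0 <= del * mu by rewrite mulr_ge0// ltW.
  by lra.
- move=> p a /andP[p0 pA] a2.
  (* Once alpha1 / 2 * p cancels, the remaining cost 2 mu p + mu alpha1 / 2 + del (p - mu) (alpha1 /
     2 - 2 mu) is at most 4 A1 mu, which [m1] bounds by om alpha2. *)
  have n1 : mu * p <= mu * A1 by rewrite ler_wpM2l// ltW.
  have n2 : mu * alpha1 <= mu * A1 by rewrite ler_wpM2l// ltW.
  have n3 : om * alpha2 <= om * a by rewrite ler_wpM2l// ltW.
  have n4 : del * ((p - mu) * (alpha1 / 2 - 2 * mu)) <= mu * A1.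
    rewrite -{3}delA -mulrA ler_wpM2l ?(ltW del0)//.
    have [pmu|pmu] := leP mu p; first by apply: ler_pM; lra.
    apply: (@le_trans _ _ 0); last by rewrite mulr_ge0// ltW.
    by rewrite mulr_le0_ge0//; lra.
  have n5 : 0 <= mu * mu by rewrite mulr_ge0// ltW.
  have n6 : 0 <= mu * A1 by rewrite mulr_ge0// ltW.
  by move: n1 n2 n3 n4 n5 n6 m1; clear; lra.
Qed.

(** Forcing of x' + a1-damping: [dv] stands for v t - v (h1 t), [xh] and [uh] for delayed values.
    Measuring the coefficients against the damping [a1] produces the ratios of row 2. *)
Lemma velocity_row (R : realType)
    (a1 a2 a3 dv xh uh tau Q1 Q3 d1 d2 d3 d4 eta H : R) :
  0 <= a1 -> 0 <= H -> `|a2| <= Q1 * a1 -> `|a3| <= Q3 * a1 ->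
  `|dv| <= tau * d3 * H -> `|xh| <= d1 * H -> `|uh| <= d4 * H ->
  Q1 * d1 + tau * d3 + Q3 * d4 <= eta * d2 ->
  `|a1 * dv - a2 * xh - a3 * uh| <= a1 * (eta * H) * d2.
Proof.
move=> a0 H0 A2 A3 V X U row.
have A1 : `|a1| <= a1 by rewrite ger0_norm.
have := ler_norm_mul A1 V; have := ler_norm_mul A2 X.
have := ler_norm_mul A3 U.
have : a1 * H * (Q1 * d1 + tau * d3 + Q3 * d4) <= a1 * H * (eta * d2).
  by rewrite ler_wpM2l// mulr_ge0.
have := ler_normB (a1 * dv - a2 * xh) (a3 * uh).
have := ler_normB (a1 * dv) (a2 * xh).
by lra.
Qed.

(** Here both x' and x have been made undelayed, at the cost of the lags [dv] and [dx], and [a2] is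
    factored out, as in row 1. *)
Lemma position_row (R : realType)
    (a1 a2 a3 dv dx uh tau1 tau2 Q1 Q3 d1 d2 d3 d4 eta H : R) :
  0 <= a2 -> 0 <= H -> `|a1| <= Q1 * a2 -> `|a3| <= Q3 * a2 ->
  `|dv| <= tau1 * d3 * H -> `|dx| <= tau2 * d2 * H -> `|uh| <= d4 * H ->
  tau2 * d2 + tau1 * Q1 * d3 + Q3 * d4 <= eta * d1 ->
  `|a1 * dv + a2 * dx - a3 * uh| <= a2 * (eta * H) * d1.
Proof.
move=> a0 H0 A1 A3 V X U row.
have A2 : `|a2| <= a2 by rewrite ger0_norm.
have := ler_norm_mul A1 V; have := ler_norm_mul A2 X.
have := ler_norm_mul A3 U.
have : a2 * H * (tau2 * d2 + tau1 * Q1 * d3 + Q3 * d4) <= a2 * H * (eta * d1).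
  by rewrite ler_wpM2l// mulr_ge0.
have := ler_normB (a1 * dv + a2 * dx) (a3 * uh).
have := ler_normD (a1 * dv) (a2 * dx).
by lra.
Qed.

Lemma control_row (R : realType) (b1 b2 du xh sigma Q d1 d4 d5 eta H : R) :
  0 <= b1 -> 0 <= H -> `|b2| <= Q * b1 ->
  `|du| <= sigma * d5 * H -> `|xh| <= d1 * H ->
  Q * d1 + sigma * d5 <= eta * d4 ->
  `|b1 * du - b2 * xh| <= b1 * (eta * H) * d4.
Proof.
move=> b0 H0 B2 U X row.
have B1 : `|b1| <= b1 by rewrite ger0_norm.
have := ler_norm_mul B1 U; have := ler_norm_mul B2 X.
have : b1 * H * (Q * d1 + sigma * d5) <= b1 * H * (eta * d4).
  by rewrite ler_wpM2l// mulr_ge0.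
have := ler_normB (b1 * du) (b2 * xh).
by lra.
Qed.

Lemma ratio_ae_le (R : realType) (t0 c C : R) (y z : R -> R) : 0 < c ->
  (forall t, t0 <= t -> c <= z t) -> (forall t, t0 <= t -> `|y t| <= C) ->
  {ae @lebesgue_measure R, forall t, t0 <= t ->
    `|y t| <= ess_norm t0 (fun t => y t / z t) * z t}.
Proof.
move=> c0 cz yC.
have yzC t : t0 <= t -> `|y t / z t| <= C / c.
  move=> t0t; have zt : 0 < z t by exact: lt_le_trans (cz t t0t).
  rewrite normrM (gtr0_norm (_ : 0 < (z t)^-1)) ?invr_gt0//.
  apply: ler_pM => //; [by rewrite invr_ge0 ltW|exact: yC|].
  by rewrite lef_pV2 ?posrE//; exact: cz.
apply: ae_imply (ess_norm_ae_le yzC) => t + t0t => /(_ t0t).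
have zt : 0 < z t by exact: lt_le_trans (cz t t0t).
by rewrite normrM (gtr0_norm (_ : 0 < (z t)^-1)) ?invr_gt0// ler_pdivrMr.
Qed.

(** * Exponential decay after the time [T0] *)

Section decay.
Variables (R : realType) (S : delay_system R).
Hypothesis hS : standing_assumptions S.
Variables (t0 alpha1 alpha2 beta1 A1 A2 : R).
Hypothesis ht0 : 0 <= t0.
Hypotheses (alpha1_gt0 : 0 < alpha1) (alpha2_gt0 : 0 < alpha2).
Hypothesis beta1_gt0 : 0 < beta1.
Hypothesis disc : 4 * A2 <= alpha1 ^+ 2.
Hypothesis coef_range : forall t, t0 <= t ->
  [/\ alpha1 <= a1 S t <= A1, alpha2 <= a2 S t <= A2 & beta1 <= b1 S t].

Variables (n1 n2 n3 m1 m2 q12 q32 q21 q31 q : R).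
Hypothesis coefs : {ae @lebesgue_measure R, forall t, t0 <= t ->
  [/\ `|a1 S t| <= n1, `|a2 S t| <= n2, `|a3 S t| <= n3, `|b1 S t| <= m1
    & `|b2 S t| <= m2] /\
  [/\ `|a1 S t| <= q12 * a2 S t, `|a3 S t| <= q32 * a2 S t,
      `|a2 S t| <= q21 * a1 S t, `|a3 S t| <= q31 * a1 S t
    & `|b2 S t| <= q * b1 S t]}.

Variables (d1 d2 d3 d4 d5 eta : R).
Hypotheses (d1_gt0 : 0 < d1) (d2_gt0 : 0 < d2) (d3_gt0 : 0 < d3).
Hypotheses (d4_gt0 : 0 < d4) (d5_gt0 : 0 < d5) (eta01 : 0 <= eta < 1).
Hypothesis row1 : tau2 S * d2 + tau1 S * q12 * d3 + q32 * d4 <= eta * d1.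
Hypothesis row2 : q21 * d1 + tau1 S * d3 + q31 * d4 <= eta * d2.
Hypothesis row3 : n2 * d1 + n1 * d2 + n3 * d4 <= eta * d3.
Hypothesis row4 : q * d1 + sigma1 S * d5 <= eta * d4.
Hypothesis row5 : m2 * d1 + m1 * d4 <= eta * d5.

Let r := max_delay S.
Let lam := alpha1 / 2.

Variables (mu th sg : R).
Hypotheses (mu_gt0 : 0 < mu) (mu_alpha1 : 8 * mu <= alpha1).
Hypothesis mu_beta1 : mu <= beta1.
Hypothesis th01 : 0 <= th < 1.
Hypothesis sg_eta : expR (mu * r) ^+ 2 * eta <= sg.
Hypothesis th_lam : lam - 2 * mu <= th * (lam - mu).
Hypothesis th_alpha1 : forall a, alpha1 <= a -> sg * a <= th * (a - mu).
Hypothesis th_beta1 : forall b, beta1 <= b -> sg * b <= th * (b - mu).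
Hypothesis th_alpha2 : forall p a, 0 <= p <= A1 -> alpha2 <= a ->
  lam * p - a + sg * a <= th * ((p - mu) * (lam - 2 * mu)).

Variables (s : R) (x v u : R -> R) (T0 : R).
Hypothesis tr : trajectory S s x v u.
Hypotheses (sT0 : s < T0 - 2 * r) (t0T0 : t0 <= T0 - 2 * r).

Let E (t : R) := expR (- mu * (t - T0)).
Let rho := expR (mu * r).

(** The barrier for x' + lam x = w tolerates a forcing w of weight d1 (lam - mu); the weight d1 (lam
    - 2 mu) leaves the margin that [th_lam] turns into the factor [th]. Bounds for x'' and u' follow
    from the equations. *)
Definition envelope (k t : R) :=
  [/\ `|x t| <= k * d1 * E t, `|v t| <= k * d2 * E t, `|u t| <= k * d4 * E t
    & `|v t + lam * x t| <= k * (d1 * (lam - 2 * mu)) * E t].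

Let r_ge0 : 0 <= r. Proof. exact: max_delay_ge0. Qed.
Let E_gt0 t : 0 < E t. Proof. exact: expR_gt0. Qed.
Let rho_ge1 : 1 <= rho.
Proof. by rewrite -[leLHS]expR0 ler_expR mulr_ge0// ltW. Qed.

Lemma E_delay (t t' : R) : t - r <= t' -> E t' <= rho * E t.
Proof.
move=> tt'; rewrite /E /rho -expRD ler_expR.
have : mu * (t - r) <= mu * t' by rewrite ler_wpM2l// ltW.
by lra.
Qed.

Lemma delay_in_domain (t : R) : T0 - 2 * r <= t ->
  [/\ t - r <= h1 S t <= t, t - r <= h2 S t <= t, t - r <= h3 S t <= t,
      t - r <= g1 S t <= t & t - r <= g2 S t <= t].
Proof.
move=> tT0; apply: delay_bounds => //; apply: le_trans tT0.
exact: le_trans t0T0.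
Qed.

(** * One contraction step on a finite horizon *)

Section contraction_step.
Variables (k T : R).
Hypothesis k_gt0 : 0 < k.
Hypothesis env : forall t, T0 - 2 * r <= t <= T -> envelope k t.

(** [G] is the scale of quantities delayed once, [H] of those delayed twice: an increment over a
    delay is governed by derivatives at earlier times, which the equations express by values delayed
    again. Hence the square in [sg_eta] and the initial window of length 2 r. *)
Let G (t : R) := k * rho * E t.
Let G_gt0 t : 0 < G t.
Proof. by rewrite !mulr_gt0// (lt_le_trans _ rho_ge1). Qed.
Let H (t : R) := rho * G t.
Let GH t : G t <= H t.
Proof. by rewrite /H -[leLHS]mul1r ler_wpM2r// ltW. Qed.

Lemma delayed_bounds (t t' : R) : T0 - r <= t <= T -> t - r <= t' <= t ->
  [/\ `|x t'| <= d1 * G t, `|v t'| <= d2 * G t & `|u t'| <= d4 * G t].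
Proof.
move=> /andP[tl tT] /andP[t'l t't].
have kE d : 0 <= d -> k * d * E t' <= d * G t.
  move=> d0; have -> : d * G t = k * d * (rho * E t) by rewrite /G; ring.
  by rewrite ler_wpM2l ?E_delay// mulr_ge0// ltW.
have [|e1 e2 e3 _] := env (t := t').
  by rewrite (le_trans t't tT) andbT; move: tl t'l; lra.
by split; [apply: le_trans e1 _|apply: le_trans e2 _|apply: le_trans e3 _];
  apply: kE; exact: ltW.
Qed.

(** On [[t', t]] the decreasing [G] is largest at [t'], and [G t'] is at most [H t]. *)
Lemma increment_bound (y : R -> R) (d : R) : 0 <= d ->
  loc_abs_continuous_from s y ->
  {ae @lebesgue_measure R, forall c, T0 - r <= c <= T ->
    derivable y c 1 /\ `|derive1 y c| <= d * G c} ->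
  forall t t' tau : R, T0 <= t <= T -> t - r <= t' <= t -> t - t' <= tau ->
    `|y t - y t'| <= tau * d * H t.
Proof.
have [r0 sT0' t0T0'] := And3 r_ge0 sT0 t0T0.
move=> d0 acy dy t t' tau /andP[tl tT] /andP[t'l t't] tau_.
have t'0 : T0 - r <= t' by lra.
have krho0 : 0 <= k * rho by rewrite mulr_ge0// ltW// (lt_le_trans _ rho_ge1).
have acy' : abs_continuous_on t' t y.
  have st : s <= t by lra.
  by apply: AC_subitv (acy _ st) => //; lra.
have {dy} dy : {ae @lebesgue_measure R, forall c, t' < c < t ->
    derivable y c 1 /\ `|derive1 y c| <= d * G t'}.
  apply: ae_imply dy => c dy /andP[t'c ct].
  have [|dyc yc] := dy.
    by rewrite (le_trans t'0 (ltW t'c)) (le_trans (ltW ct) tT).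
  split => //; apply: le_trans yc _; rewrite ler_wpM2l// /G ler_wpM2l//.
  by rewrite ler_expR !mulNr lerN2 ler_wpM2l ?(ltW mu_gt0)// lerD2r ltW.
have L0 : 0 <= d * G t' by rewrite mulr_ge0// ltW.
have := AC_lipschitz L0 acy' dy (lexx t') t't (lexx t).
move=> /le_trans; apply.
have -> : tau * d * H t = d * (k * rho * (rho * E t)) * tau.
  by rewrite /H /G; ring.
apply: ler_pM => //; first by rewrite subr_ge0.
by rewrite /G !ler_wpM2l// E_delay.
Qed.

(** Row 3 with [eta] estimated by 1; the gain of a factor comes from rows 1, 2 and 4. Row 5 serves
    u' in the same way. *)
Lemma velocity_derive_bound :
  {ae @lebesgue_measure R, forall c, T0 - r <= c <= T ->
    derivable v c 1 /\ `|derive1 v c| <= d3 * G c}.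
Proof.
have [r0 sT0' t0T0'] := And3 r_ge0 sT0 t0T0.
apply: ae_imply (ae_and coefs (velocity_equation tr)).
move=> c [coef eqv] /[dup] cI /andP[cl _].
have [|dv ->] := eqv; first by lra.
split => //; have [|[B1 B2 B3 _ _] _] := coef; first by lra.
have [|H1 H2 H3 _ _] := @delay_in_domain c; first by lra.
have [_ V _] := delayed_bounds cI H1; have [X _ _] := delayed_bounds cI H2.
have [_ _ U] := delayed_bounds cI H3.
rewrite normrN; apply: le_trans (ler_normD _ _) _.
have := ler_normD (a1 S c * v (h1 S c)) (a2 S c * x (h2 S c)).
have := ler_norm_mul B1 V; have := ler_norm_mul B2 X.
have := ler_norm_mul B3 U.
have : (n2 * d1 + n1 * d2 + n3 * d4) * G c <= d3 * G c.
  rewrite ler_wpM2r//; first exact: ltW.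
  apply: le_trans row3 _; rewrite ler_piMl//; first exact: ltW.
  by case/andP: eta01 => _ /ltW.
by lra.
Qed.

Lemma control_derive_bound :
  {ae @lebesgue_measure R, forall c, T0 - r <= c <= T ->
    derivable u c 1 /\ `|derive1 u c| <= d5 * G c}.
Proof.
have [r0 sT0' t0T0'] := And3 r_ge0 sT0 t0T0.
apply: ae_imply (ae_and coefs (control_equation tr)).
move=> c [coef equ] /[dup] cI /andP[cl _].
have [|du ->] := equ; first by lra.
split => //; have [|[_ _ _ B1 B2] _] := coef; first by lra.
have [|_ _ _ G1 G2] := @delay_in_domain c; first by lra.
have [_ _ U] := delayed_bounds cI G1; have [X _ _] := delayed_bounds cI G2.
rewrite normrN; apply: le_trans (ler_normD _ _) _.
have := ler_norm_mul B1 U; have := ler_norm_mul B2 X.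
have : (m2 * d1 + m1 * d4) * G c <= d5 * G c.
  rewrite ler_wpM2r//; first exact: ltW.
  apply: le_trans row5 _; rewrite ler_piMl//; first exact: ltW.
  by case/andP: eta01 => _ /ltW.
by lra.
Qed.

Lemma position_derive_bound :
  {ae @lebesgue_measure R, forall c, T0 - r <= c <= T ->
    derivable x c 1 /\ `|derive1 x c| <= d2 * G c}.
Proof.
have [r0 sT0' t0T0'] := And3 r_ge0 sT0 t0T0.
apply: aeW => c /andP[cl cT].
have [|dx xv] := position_derive tr (t := c); first by lra.
split; rewrite // derive1E xv.
have [_ + _] : [/\ `|x c| <= d1 * G c, `|v c| <= d2 * G c & `|u c| <= d4 * G c].
  by apply: (@delayed_bounds c); rewrite ?cl ?cT// lexx andbT gerBl.
by [].
Qed.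

Variable c : R.
Hypothesis c_gt0 : 0 < c.
Hypothesis env0 : forall t, T0 - 2 * r <= t <= T0 -> envelope c t.
Hypothesis T0T : T0 <= T.

Let time_facts : [/\ 0 <= r, s < T0 - 2 * r, t0 <= T0 - 2 * r & T0 <= T].
Proof. by []. Qed.

Let parameter_facts :
  [/\ 0 < alpha1, 0 < alpha2, 0 < beta1, 0 < mu & 8 * mu <= alpha1].
Proof. by []. Qed.

Let K := Num.max c (th * k).
Let thK : th * k <= K. Proof. by rewrite /K le_max lexx orbT. Qed.

Lemma envelope_init t : T0 - 2 * r <= t <= T0 -> envelope K t.
Proof.
move=> /env0[e1 e2 e3 e4].
have cK y d : `|y| <= c * d * E t -> `|y| <= K * d * E t.
  move=> ycd; apply: le_trans (ycd) _.
  rewrite -!mulrA ler_wpM2r//; last by rewrite /K le_max lexx.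
  (* The sign of [d * E t] is read off from 0 <= |y| <= c d E. *)
  rewrite -(pmulr_rge0 _ c_gt0) mulrA; exact: le_trans ycd.
by split; exact: cK.
Qed.

Let init : [/\ `|x T0| <= K * d1, `|v T0| <= K * d2, `|u T0| <= K * d4
  & `|v T0 + lam * x T0| <= K * (d1 * (lam - 2 * mu))].
Proof.
have [r0 sT0' t0T0'] := And3 r_ge0 sT0 t0T0.
have [|e1 e2 e3 e4] := @envelope_init T0.
  by rewrite lexx andbT; lra.
have E1 : E T0 = 1 by rewrite /E subrr mulr0 expR0.
by rewrite E1 !mulr1 in e1 e2 e3 e4.
Qed.

Let tT0 (t : R) : T0 < t < T -> [/\ T0 <= t <= T, T0 - r <= t <= T & s < t].
Proof.
by have [r0 sT0' t0T0'] := And3 r_ge0 sT0 t0T0; move=> ?; split; lra.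
Qed.

Let eta_H t : eta * H t <= sg * (k * E t).
Proof.
have -> : eta * H t = (rho ^+ 2 * eta) * (k * E t) by rewrite /H /G; ring.
by rewrite ler_wpM2r// mulr_ge0// ltW.
Qed.

(** Turns the forcing bound of a row into the hypothesis of [barrier] with damping [a], through eta
    H <= sg k E, then sg a <= th (a - mu), then th k <= K. *)
Lemma damping_le (a d t : R) : 0 <= d -> 0 <= a -> mu <= a ->
  sg * a <= th * (a - mu) -> a * (eta * H t) * d <= (a - mu) * (K * d * E t).
Proof.
move=> d0 a0 mua sga.
have dE0 : 0 <= d * (k * E t) by rewrite !mulr_ge0// ltW.
apply: (@le_trans _ _ (a * (sg * (k * E t)) * d)).
  by rewrite ler_wpM2r// ler_wpM2l.
have -> : a * (sg * (k * E t)) * d = sg * a * (d * (k * E t)) by ring.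
apply: le_trans (ler_wpM2r dE0 sga) _.
have -> : th * (a - mu) * (d * (k * E t)) = (a - mu) * (th * k * (d * E t)).
  by ring.
rewrite ler_wpM2l ?subr_ge0// -[leRHS]mulrA ler_wpM2r//.
by rewrite mulr_ge0// ltW.
Qed.

(** v' + a1 v = a1 (v - v(h1)) - a2 x(h2) - a3 u(h3) has damping [a1] and forcing bounded by row
    2. *)
Lemma velocity_envelope t : T0 <= t <= T -> `|v t| <= K * d2 * E t.
Proof.
have [r0 sT0' t0T0' T0T'] := time_facts.
have [al1_0 al2_0 be1_0 mu0 mual] := parameter_facts.
move: t; have [_ vi _ _] := init.
have sT : s <= T by lra.
have acv : abs_continuous_on T0 T v.
  by apply: AC_subitv (velocity_AC tr sT) => //; lra.
apply: (barrier (p := a1 S)) acv vi _.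
apply: ae_imply (ae_and coefs (velocity_equation tr)) => t [coef eqv] tI.
have [tI0 tI1 st] := tT0 tI.
have [dv dvE] := eqv st; have t0t : t0 <= t by lra.
have [/andP[al1 _] _ _] := coef_range t0t.
have a1_0 : 0 <= a1 S t by lra.
split => //; have [_ [_ _ C2 C3 _]] := coef t0t.
have [|H1 H2 H3 _ _] := @delay_in_domain t; first by lra.
have h1tau : t - h1 S t <= tau1 S.
  case: hS => _ [_ [[[_ D1] _ _] _]].
  by have /andP[] := D1 _ (le_trans ht0 t0t).
have dV := increment_bound (ltW d3_gt0) (velocity_AC tr)
  velocity_derive_bound tI0 H1 h1tau.
have [X _ _] := delayed_bounds tI1 H2; have [_ _ U] := delayed_bounds tI1 H3.
have dH d : 0 < d -> d * G t <= d * H t by move=> ?; rewrite ler_wpM2l// ltW.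
have := velocity_row a1_0 (ltW (lt_le_trans (G_gt0 t) (GH t))) C2 C3 dV
  (le_trans X (dH _ d1_gt0)) (le_trans U (dH _ d4_gt0)) row2.
rewrite dvE; have -> : - (a1 S t * v (h1 S t) + a2 S t * x (h2 S t) +
    a3 S t * u (h3 S t)) + a1 S t * v t =
  a1 S t * (v t - v (h1 S t)) - a2 S t * x (h2 S t) - a3 S t * u (h3 S t).
  by ring.
move=> /le_trans; apply; apply: damping_le => //; first exact: ltW.
  by lra.
exact: th_alpha1.
Qed.

(** The same argument with damping [b1] and row 4. *)
Lemma control_envelope t : T0 <= t <= T -> `|u t| <= K * d4 * E t.
Proof.
have [r0 sT0' t0T0' T0T'] := time_facts.
have [al1_0 al2_0 be1_0 mu0 mual] := parameter_facts.
move: t; have [_ _ ui _] := init.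
have sT : s <= T by lra.
have acu : abs_continuous_on T0 T u.
  by apply: AC_subitv (control_AC tr sT) => //; lra.
apply: (barrier (p := b1 S)) acu ui _.
apply: ae_imply (ae_and coefs (control_equation tr)) => t [coef equ] tI.
have [tI0 tI1 st] := tT0 tI.
have [du duE] := equ st; have t0t : t0 <= t by lra.
have [_ _ be1] := coef_range t0t.
have b1_0 : 0 <= b1 S t by lra.
split => //; have [_ [_ _ _ _ C2]] := coef t0t.
have [|_ _ _ G1 G2] := @delay_in_domain t; first by lra.
have g1sigma : t - g1 S t <= sigma1 S.
  case: hS => _ [_ [_ [[_ D1] _]]].
  by have /andP[] := D1 _ (le_trans ht0 t0t).
have dU := increment_bound (ltW d5_gt0) (control_AC tr)
  control_derive_bound tI0 G1 g1sigma.
have [X _ _] := delayed_bounds tI1 G2.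
have dH d : 0 < d -> d * G t <= d * H t by move=> ?; rewrite ler_wpM2l// ltW.
have := control_row b1_0 (ltW (lt_le_trans (G_gt0 t) (GH t))) C2 dU
  (le_trans X (dH _ d1_gt0)) row4.
rewrite duE; have -> : - (b1 S t * u (g1 S t) + b2 S t * x (g2 S t)) +
    b1 S t * u t = b1 S t * (u t - u (g1 S t)) - b2 S t * x (g2 S t).
  by ring.
move=> /le_trans; apply; apply: damping_le => //; first exact: ltW.
  exact: le_trans be1.
exact: th_beta1.
Qed.

(** x' + lam x is bounded by the fourth component of the old envelope, with no delay involved. *)
Lemma position_envelope t : T0 <= t <= T -> `|x t| <= K * d1 * E t.
Proof.
have [r0 sT0' t0T0' T0T'] := time_facts.
have [al1_0 al2_0 be1_0 mu0 mual] := parameter_facts.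
move: t; have [xi _ _ _] := init.
have sT : s <= T by lra.
have acx : abs_continuous_on T0 T x.
  by apply: AC_subitv (position_AC tr sT) => //; lra.
apply: (barrier (p := fun=> lam)) acx xi _.
apply: aeW => t tI; have [tI0 _ st] := tT0 tI.
have [dx xv] := position_derive tr st; split => //; first by rewrite /lam; lra.
have [|_ _ _ W] := env (t := t); first by lra.
rewrite derive1E xv; apply: le_trans W _.
have dE0 : 0 <= k * (d1 * E t) by rewrite !mulr_ge0// ltW.
have -> : k * (d1 * (lam - 2 * mu)) * expR (- mu * (t - T0)) =
  (lam - 2 * mu) * (k * (d1 * E t)) by rewrite /E; ring.
apply: le_trans (ler_wpM2r dE0 th_lam) _.
have -> : th * (lam - mu) * (k * (d1 * E t)) =
  (lam - mu) * (th * k * (d1 * E t)) by ring.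
rewrite ler_wpM2l//; first by rewrite /lam; lra.
by rewrite -[leRHS]mulrA ler_wpM2r// mulr_ge0// ltW.
Qed.

(* With w = x' + lam x the second-order equation becomes the cooperative system
   x' = - lam x + w, w' = - (a1 - lam) w + (lam (a1 - lam) - a2) x + f, whose
   coupling lam (a1 - lam) - a2 is nonnegative because alpha1^2 >= 4 A2. *)
Lemma momentum_envelope t : T0 <= t <= T ->
  `|v t + lam * x t| <= K * (d1 * (lam - 2 * mu)) * E t.
Proof.
have [r0 sT0' t0T0' T0T'] := time_facts.
have [al1_0 al2_0 be1_0 mu0 mual] := parameter_facts.
move: t; have [_ _ _ wi] := init.
have sT : s <= T by lra.
have lam0 : 0 < lam by rewrite /lam; lra.
have acx : abs_continuous_on T0 T x.
  by apply: AC_subitv (position_AC tr sT) => //; lra.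
have acv : abs_continuous_on T0 T v.
  by apply: AC_subitv (velocity_AC tr sT) => //; lra.
have acw : abs_continuous_on T0 T (fun t => v t + lam * x t).
  apply: (AC_dominated (c := 1 + lam) acv acx); first by lra.
  move=> p t _ _ _.
  have -> : v t + lam * x t - (v p + lam * x p) =
    (v t - v p) + lam * (x t - x p) by ring.
  apply: le_trans (ler_normD _ _) _; rewrite normrM (gtr0_norm lam0).
  have : 0 <= lam * `|v t - v p| by rewrite mulr_ge0// ltW.
  have := normr_ge0 (x t - x p).
  by lra.
apply: (barrier (y := fun t => v t + lam * x t)
  (p := fun t => a1 S t - lam)) acw wi _.
apply: ae_imply (ae_and coefs (velocity_equation tr)) => t [coef eqv] tI.
have [tI0 tI1 st] := tT0 tI.
have [dv dvE] := eqv st; have t0t : t0 <= t by lra.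
have [/andP[al1 a1A] /andP[al2 a2A] _] := coef_range t0t.
have dx := position_derive tr st.
have dv1 := is_derive1_derivable dv.
have dw : is_derive t 1 (fun t => v t + lam * x t) (derive1 v t + lam * v t).
  exact: is_deriveD.
have [dw1 dwE] := dw.
have p0 : 0 <= a1 S t - lam by rewrite /lam; lra.
split => //; rewrite derive1E dwE dvE.
have a2_0 : 0 <= a2 S t by lra.
have [_ [C1 C3 _ _ _]] := coef t0t.
have [|H1 H2 H3 _ _] := @delay_in_domain t; first by lra.
have [h1tau h2tau] : t - h1 S t <= tau1 S /\ t - h2 S t <= tau2 S.
  case: hS => _ [_ [[[_ D1] [_ D2] _] _]].
  by split; [have /andP[] := D1 _ (le_trans ht0 t0t)
            |have /andP[] := D2 _ (le_trans ht0 t0t)].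
have dV := increment_bound (ltW d3_gt0) (velocity_AC tr)
  velocity_derive_bound tI0 H1 h1tau.
have dX := increment_bound (ltW d2_gt0) (position_AC tr)
  position_derive_bound tI0 H2 h2tau.
have [_ _ U] := delayed_bounds tI1 H3.
have dH d : 0 < d -> d * G t <= d * H t by move=> ?; rewrite ler_wpM2l// ltW.
have row := position_row a2_0 (ltW (lt_le_trans (G_gt0 t) (GH t))) C1 C3 dV dX
  (le_trans U (dH _ d4_gt0)) row1.
have [|X _ _ _] := env (t := t); first by lra.
set cpl := lam * (a1 S t - lam) - a2 S t.
(* The choice lam = alpha1 / 2 maximises lam (alpha1 - lam), with value alpha1^2 / 4 >= A2. *)
have cpl0 : 0 <= cpl.
  have : lam * (alpha1 - lam) <= lam * (a1 S t - lam).
    by rewrite ler_wpM2l ?lerD2r// ltW.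
  by move: disc; rewrite /cpl /lam expr2; lra.
have -> : - (a1 S t * v (h1 S t) + a2 S t * x (h2 S t) + a3 S t * u (h3 S t)) +
    lam * v t + (a1 S t - lam) * (v t + lam * x t) =
  (a1 S t * (v t - v (h1 S t)) + a2 S t * (x t - x (h2 S t)) -
     a3 S t * u (h3 S t)) + cpl * x t.
  by rewrite /cpl; ring.
apply: le_trans (ler_normD _ _) _.
have cplX : `|cpl * x t| <= cpl * (k * d1 * E t).
  by rewrite normrM ger0_norm// ler_wpM2l.
apply: le_trans (lerD row cplX) _.
have kE0 : 0 <= d1 * (k * E t) by rewrite !mulr_ge0// ltW.
(* Coupling and forcing together have the coefficient lam p - a2 + sg a2 with p = a1 - lam, the left
   side of [th_alpha2]. *)
apply: (@le_trans _ _ ((cpl + sg * a2 S t) * (d1 * (k * E t)))).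
  have : a2 S t * (eta * H t) * d1 <= a2 S t * (sg * (k * E t)) * d1.
    by rewrite ler_wpM2r ?(ltW d1_gt0)// ler_wpM2l.
  by lra.
have pA : 0 <= a1 S t - lam <= A1 by lra.
apply: le_trans (ler_wpM2r kE0 (th_alpha2 pA al2)) _.
have -> : th * ((a1 S t - lam - mu) * (lam - 2 * mu)) * (d1 * (k * E t)) =
  (a1 S t - lam - mu) * (th * k * (d1 * (lam - 2 * mu) * E t)) by ring.
rewrite ler_wpM2l//; first by rewrite /lam; lra.
rewrite -[leRHS]mulrA ler_wpM2r// !mulr_ge0// ?(ltW d1_gt0) ?(ltW (E_gt0 t))//.
by rewrite /lam; lra.
Qed.

Lemma envelope_contract t : T0 - 2 * r <= t <= T -> envelope K t.
Proof.
move=> /andP[tl tT]; have [tT0'|tT0'] := leP t T0.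
  by apply: envelope_init; rewrite tl.
have tI : T0 <= t <= T by rewrite (ltW tT0').
split; [exact: position_envelope|exact: velocity_envelope
  |exact: control_envelope|exact: momentum_envelope].
Qed.

End contraction_step.

(** * From the contraction step to the decay estimate *)

(** Converts a common bound on |x|, |v|, |u| into an envelope: one reciprocal weight per component,
    with 1 + lam for v + lam x. *)
Let C := 1 / d1 + 1 / d2 + 1 / d4 + (1 + lam) / (d1 * (lam - 2 * mu)).

Let E_noninc (p t : R) : p <= t -> E t <= E p.
Proof.
by move=> pt; rewrite ler_expR !mulNr lerN2 ler_wpM2l ?(ltW mu_gt0)// lerD2r.
Qed.

Let lam_facts : 0 < lam /\ 0 < lam - 2 * mu.
Proof. by have := alpha1_gt0; have := mu_alpha1; rewrite /lam; split; lra. Qed.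

Let C_ge : [/\ 1 / d1 <= C, 1 / d2 <= C, 1 / d4 <= C
  & (1 + lam) / (d1 * (lam - 2 * mu)) <= C].
Proof.
have [lam0 lam2] := lam_facts.
have i1 : 0 < 1 / d1 by rewrite divr_gt0.
have i2 : 0 < 1 / d2 by rewrite divr_gt0.
have i4 : 0 < 1 / d4 by rewrite divr_gt0.
have i6 : 0 < (1 + lam) / (d1 * (lam - 2 * mu)).
  by rewrite divr_gt0 ?mulr_gt0// addr_gt0.
by rewrite /C; split; lra.
Qed.

Lemma envelope_of_bound (B e t : R) : 0 < e -> e <= E t ->
  `|x t| <= B -> `|v t| <= B -> `|u t| <= B -> envelope (C * (B / e)) t.
Proof.
move=> e0 eE xB vB uB; have [lam0 lam2] := lam_facts.
have [c1 c2 c4 c6] := C_ge.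
have B0 : 0 <= B by exact: le_trans xB.
have le m d : 0 <= m -> 0 < d -> m / d <= C -> m * B <= C * (B / e) * d * E t.
  move=> m0 d0; rewrite ler_pdivrMr// => mC.
  have -> : C * (B / e) * d * E t = C * d * (B * (E t / e)) by ring.
  apply: ler_pM => //; rewrite ler_peMr// ler_pdivlMr// mul1r.
  exact: eE.
split.
- by apply: le_trans xB _; rewrite -[leLHS]mul1r; apply: le.
- by apply: le_trans vB _; rewrite -[leLHS]mul1r; apply: le.
- by apply: le_trans uB _; rewrite -[leLHS]mul1r; apply: le.
- apply: (@le_trans _ _ ((1 + lam) * B)).
    apply: le_trans (ler_normD _ _) _; rewrite normrM (gtr0_norm lam0).
    by rewrite mulrDl mul1r lerD// ler_wpM2l// ltW.
  by apply: le => //; [rewrite addr_ge0// ltW|rewrite mulr_gt0].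
Qed.

(** The contraction is run on each finite horizon [T]; the resulting constant [C * N] is the same
    for all of them. *)
Lemma decay_estimate (N : R) : 0 < N ->
  (forall t, T0 - 2 * r <= t <= T0 -> [/\ `|x t| <= N, `|v t| <= N & `|u t| <= N]) ->
  forall t, T0 <= t -> `|x t| <= C * d1 * N * E t /\ `|u t| <= C * d4 * N * E t.
Proof.
move=> N0 init T T0T.
have r0 := r_ge0; have sT0' := sT0.
have C0 : 0 < C.
  by have [c1 _ _ _] := C_ge; apply: lt_le_trans c1; rewrite divr_gt0.
pose P k := forall t, T0 - 2 * r <= t <= T -> envelope k t.
suff /(_ T) [] : P (C * N).
- by rewrite lexx andbT; lra.
- move=> xE _ uE _.
  have -> : C * d1 * N = C * N * d1 by ring.
  by have -> : C * d4 * N = C * N * d4 by ring.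
have [th0 th1] := andP th01.
apply: (contraction_bound (th := th)) => //; first by rewrite mulr_gt0.
- move=> k k0 Pk; apply: (@envelope_contract k T) => //; first by rewrite mulr_gt0.
  (* Up to [T0] the exponential is at least its value 1 at [T0], so e = 1 is admissible. *)
  move=> t tI; rewrite -[N]divr1; have [xN vN uN] := init t tI.
  apply: envelope_of_bound => //.
  have <- : E T0 = 1 by rewrite /E subrr mulr0 expR0.
  by apply: E_noninc; case/andP: tI.
- have sT : s <= T by lra.
  have [Cx Cx0 xC] := AC_bounded sT (position_AC tr sT).
  have [Cv Cv0 vC] := AC_bounded sT (velocity_AC tr sT).
  have [Cu Cu0 uC] := AC_bounded sT (control_AC tr sT).
  exists (C * ((Cx + Cv + Cu + 1) / E T)).
    by rewrite mulr_gt0// divr_gt0//; lra.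
  move=> t /andP[tl tT].
  have sI : s <= t <= T by rewrite tT andbT; lra.
  have := xC t sI; have := vC t sI; have := uC t sI => uB vB xB.
  by apply: envelope_of_bound; rewrite ?E_noninc//; lra.
Qed.

End decay.

Theorem theorem2p1 (R : realType) (S : delay_system R)
    (hS : standing_assumptions S)
    (t0 alpha1 alpha2 beta1 A1 A2 A3 B1 B2 : R)
    (ht0 : 0 <= t0)
    (halpha1 : 0 < alpha1) (halpha2 : 0 < alpha2) (hbeta1 : 0 < beta1)
    (ha1 : forall t, t0 <= t -> alpha1 <= a1 S t <= A1)
    (ha2 : forall t, t0 <= t -> alpha2 <= a2 S t <= A2)
    (ha3 : forall t, t0 <= t -> `|a3 S t| <= A3)
    (hb1 : forall t, t0 <= t -> beta1 <= b1 S t <= B1)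
    (hb2 : forall t, t0 <= t -> `|b2 S t| <= B2)
    (hdisc : 4 * A2 <= alpha1 ^+ 2)
    (hA : spectral_radius (comparison_matrix S t0) < 1 \/
          nonsingular_M_matrix (1%:M - comparison_matrix S t0)) :
  uniformly_exponentially_stable S.
Proof.
have [tau1_0 tau2_0 sigma1_0] : [/\ 0 <= tau1 S, 0 <= tau2 S & 0 <= sigma1 S].
  case: hS => _ [_ [[[_ D1] [_ D2] _] [[_ D3] _]]].
  have := D1 _ (lexx 0); have := D2 _ (lexx 0); have := D3 _ (lexx 0).
  by split; lra.
have alA : alpha1 <= A1 by have := ha1 _ (lexx t0); lra.
have r0 := max_delay_ge0 hS; set r := max_delay S in r0.
have normle c C y : 0 < c -> c <= y <= C -> `|y| <= C.
  by move=> c0 /andP[cy yC]; rewrite ger0_norm// (le_trans (ltW c0)).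
have na1 t : t0 <= t -> `|a1 S t| <= A1.
  by move=> /ha1; exact: normle.
have na2 t : t0 <= t -> `|a2 S t| <= A2.
  by move=> /ha2; exact: normle.
have nb1 t : t0 <= t -> `|b1 S t| <= B1.
  by move=> /hb1; exact: normle.
have la1 t : t0 <= t -> alpha1 <= a1 S t by move=> /ha1/andP[].
have la2 t : t0 <= t -> alpha2 <= a2 S t by move=> /ha2/andP[].
have lb1 t : t0 <= t -> beta1 <= b1 S t by move=> /hb1/andP[].
have coefs : {ae @lebesgue_measure R, forall t, t0 <= t ->
  [/\ `|a1 S t| <= ess_norm t0 (a1 S), `|a2 S t| <= ess_norm t0 (a2 S),
      `|a3 S t| <= ess_norm t0 (a3 S), `|b1 S t| <= ess_norm t0 (b1 S)
    & `|b2 S t| <= ess_norm t0 (b2 S)] /\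
  [/\ `|a1 S t| <= ess_norm t0 (fun t => a1 S t / a2 S t) * a2 S t,
      `|a3 S t| <= ess_norm t0 (fun t => a3 S t / a2 S t) * a2 S t,
      `|a2 S t| <= ess_norm t0 (fun t => a2 S t / a1 S t) * a1 S t,
      `|a3 S t| <= ess_norm t0 (fun t => a3 S t / a1 S t) * a1 S t
    & `|b2 S t| <= ess_norm t0 (fun t => b2 S t / b1 S t) * b1 S t]}.
  apply: ae_imply (ae_and
    (ae_and (ae_and (ess_norm_ae_le na1) (ess_norm_ae_le na2))
      (ae_and (ess_norm_ae_le ha3)
        (ae_and (ess_norm_ae_le nb1) (ess_norm_ae_le hb2))))
    (ae_and (ae_and (ratio_ae_le halpha2 la2 na1) (ratio_ae_le halpha2 la2 ha3))
      (ae_and (ratio_ae_le halpha1 la1 na2)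
        (ae_and (ratio_ae_le halpha1 la1 ha3) (ratio_ae_le hbeta1 lb1 hb2))))).
  move=> t [[[c1 c2] [c3 [c4 c5]]] [[r1 r2] [r3 [r4 r5]]]] t0t.
  by split; split; auto.
have [d1 [d2 [d3 [d4 [d5 [eta [[d1_0 d2_0 d3_0 d4_0 d5_0]
  [eta01 [row1 row2 row3 row4 row5]]]]]]]]] :=
  comparison_matrix_rows tau1_0 tau2_0 sigma1_0 hA.
have [mu [th [sg [[mu0 mu_al mu_be th01 sg_eta] [th1 th2 th3 th4]]]]] :=
  decay_parameters halpha1 halpha2 hbeta1 alA r0 eta01.
(* With T0 = s + L, the window starts at T0 - 2 r = s + t0 + 1, beyond both [s] and [t0]. *)
pose L := t0 + 2 * r + 1.
have L0 : 0 <= L by rewrite /L !addr_ge0// mulr_ge0.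
have [Cg Cg1 growth] := growth_bound hS L0.
pose lam := alpha1 / 2.
pose C := 1 / d1 + 1 / d2 + 1 / d4 + (1 + lam) / (d1 * (lam - 2 * mu)).
have C0 : 0 <= C.
  have lam2 : 0 <= lam - 2 * mu.
    by rewrite /lam; move: halpha1 mu_al; clear; lra.
  have lam0 : 0 <= lam by rewrite divr_ge0// ltW.
  by rewrite !addr_ge0// ?divr_ge0// ?mulr_ge0// ?addr_ge0// ltW.
(* The summand 1 serves the growth phase, the other two the decay of x and u. *)
pose D := 1 + C * d1 + C * d4.
have Cd1 : 0 <= C * d1 by rewrite mulr_ge0// ltW.
have Cd4 : 0 <= C * d4 by rewrite mulr_ge0// ltW.
have D1 : 1 <= D by rewrite /D -addrA lerDl addr_ge0.
(* The exponential pays for measuring the decay from [s] instead of s + L. *)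
pose M := Cg * D * expR (mu * L).
have Cg0 : 0 < Cg by exact: lt_le_trans Cg1.
have M0 : 0 < M by rewrite !mulr_gt0// ?expR_gt0// (lt_le_trans _ D1).
exists M, mu; split => // s phi1 phi2 psi s0 [_ [K1 phi1K]] [_ [K2 phi2K]] [_ [K3 psiK]].
move=> x u sol t st.
set V := [set _ | _ in _].
have hs : history S s s by rewrite /history/= in_itv/= lexx andbT gerBl.
have ubV : has_ubound V.
  exists (K1 + K2 + K3) => _ [p hp <-].
  by rewrite !lerD ?phi1K ?phi2K ?psiK.
have Vle p : history S s p -> `|phi1 p| + `|phi2 p| + `|psi p| <= sup V.
  by move=> hp; apply: ub_le_sup => //; exists p.
have V0 : 0 <= sup V by apply: le_trans (Vle _ hs); rewrite !addr_ge0.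
pose W := M * expR (- mu * (t - s)).
have W0 : 0 < W by rewrite mulr_gt0// expR_gt0.
(* The supremum may be 0, while the estimates ask for a positive bound [N]; the slack [e / W]
   changes the final bound only by [e]. *)
apply/ler_addgt0Pr => e e0.
pose N := sup V + e / W.
have N0 : 0 < N by rewrite /N ltr_wpDl// divr_gt0.
have WN : W * N = W * sup V + e.
  by rewrite /N mulrDr mulrCA divff ?mulr1// gt_eqF.
rewrite -/W -WN.
have VN : sup V <= N by rewrite /N lerDl ltW// divr_gt0.
have tr := solution_trajectory sol.
have hist p : history S s p ->
    [/\ `|x p| <= N, `|xdot s phi2 x p| <= N & `|u p| <= N].
  move=> hp; have [ic _ _ _ _] := sol; have [-> ->] := ic p hp.
  have ps : p <= s by move: hp; rewrite /history/= in_itv/= => /andP[].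
  rewrite /xdot ps; have := le_trans (Vle p hp) VN.
  have := normr_ge0 (phi1 p); have := normr_ge0 (phi2 p).
  have := normr_ge0 (psi p); clear.
  by move=> p1 p2 p3 pN; split; lra.
have gr := growth s x _ u N s0 N0 tr hist.
have CgN : 0 < Cg * N by rewrite mulr_gt0.
have [tL|tL] := leP t (s + L).
  have [|xg _ ug] := gr t; first by rewrite st.
  have e1 : 1 <= expR (mu * L) * expR (- mu * (t - s)).
    rewrite -expRD -[leLHS]expR0 ler_expR.
    have : mu * (t - s) <= mu * L by rewrite ler_wpM2l ?(ltW mu0)// lerBlDl.
    by clear; lra.
  have bnd : Cg * N <= W * N.
    have -> : W * N = Cg * N * (D * (expR (mu * L) * expR (- mu * (t - s)))).
      by rewrite /W /M; ring.
    by rewrite ler_peMr ?(ltW CgN)// -[leLHS]mulr1 ler_pM.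
  by rewrite ge_max (le_trans xg bnd) (le_trans ug bnd).
have range p : t0 <= p ->
    [/\ alpha1 <= a1 S p <= A1, alpha2 <= a2 S p <= A2 & beta1 <= b1 S p].
  by move=> t0p; split; [exact: ha1|exact: ha2|exact: lb1].
have T0E : s + L - 2 * r = s + t0 + 1 by rewrite /L; ring.
have sT0 : s < s + L - 2 * r by rewrite T0E -addrA ltrDl ltr_wpDl.
have t0T0 : t0 <= s + L - 2 * r.
  by rewrite T0E -addrA addrCA lerDl addr_ge0.
have init p : s + L - 2 * r <= p <= s + L ->
    [/\ `|x p| <= Cg * N, `|xdot s phi2 x p| <= Cg * N & `|u p| <= Cg * N].
  by move=> /andP[pl pT]; apply: gr; rewrite pT andbT (le_trans (ltW sT0)).
have [xd ud] := decay_estimate hS ht0 halpha1 halpha2 hbeta1 hdisc range coefs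
  d1_0 d2_0 d3_0 d4_0 d5_0 eta01 row1 row2 row3 row4 row5 mu0 mu_al mu_be th01
  sg_eta th1 th2 th3 th4 tr sT0 t0T0 CgN init (ltW tL).
have split_exp : expR (mu * L) * expR (- mu * (t - s)) =
    expR (- mu * (t - (s + L))).
  by rewrite -expRD; congr expR; ring.
have bnd c : c <= D ->
    c * (Cg * N) * expR (- mu * (t - (s + L))) <= W * N.
  move=> cD; have -> : W * N =
      D * (Cg * N) * (expR (mu * L) * expR (- mu * (t - s))).
    by rewrite /W /M; ring.
  by rewrite split_exp ler_wpM2r ?expR_ge0// ler_wpM2r// ltW.
have Dd1 : C * d1 <= D by rewrite /D; move: Cd1 Cd4; clear; lra.
have Dd4 : C * d4 <= D by rewrite /D; move: Cd1 Cd4; clear; lra.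
by rewrite ge_max (le_trans xd (bnd _ Dd1)) (le_trans ud (bnd _ Dd4)).
Qed.
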